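(* Let $(G,B)$ be a connected finite graph with boundary, $|B|\ge2$, equipped with the unit weight, with vertex set $V$ and interior $\Omega=V\setminus B$. Let $\mu_i$ and $\sigma_i$ be its Laplacian and Steklov eigenvalues. Then $\sigma_i=\mu_i$ for all $i=1,2,\dots,|B|$ if and only if all the following statements are true: (1) Each interior vertex is either adjacent to all boundary vertices or adjacent to no boundary vertex. (2) Let $\Omega_0$ be the set of interior vertices that are not adjacent to any boundary vertex and $\Omega_1=\Omega\setminus\Omega_0$. Then $|E(\Omega_0,\Omega_1)|=|\Omega_0||\Omega_1|$, i.e. $x$ and $y$ are adjacent for any $x\in\Omega_0$ and $y\in\Omega_1$. (3) $\mu_2(\Omega_1)\ge|\Omega_1|-|\Omega_0|-|B|$, where $\mu_2(\Omega_1)$ is the second Laplacian eigenvalue of the induced graph of $G$ on $\Omega_1$ with the unit weight.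
   Context: All graphs are finite and simple, and $G$ is connected, with vertex set $V$ and edge set $E$. The unit weight means that vertex measure $m\equiv1$ on $V$ and edge weight $w\equiv1$ on $E$ are used; $w_{xy}=1$ if $\{x,y\}\in E$ and $w_{xy}=0$ otherwise. Graph with boundary: $(G,B)$ is a graph together with a nonempty set $B\subset V$ (the boundary) such that no two vertices of $B$ are adjacent and every vertex of $B$ is adjacent to some vertex of $\Omega:=V\setminus B$ (the interior). $E(S,T)$ denotes the set of edges with one endpoint in $S$ and the other in $T$. Laplacian: for $u\in\mathbb{R}^V$, $\Delta u(x)=\sum_{y\in V}(u(y)-u(x))w_{xy}$. The eigenvalues of the nonnegative self-adjoint operator $-\Delta$, counted with multiplicity, are $0=\mu_1<\mu_2\le\cdots\le\mu_{|V|}$. Steklov eigenvalues: for $f\in\mathbb{R}^B$ let $u_f\in\mathbb{R}^V$ be the unique function with $u_f=f$ on $B$ and $\Delta u_f=0$ on $\Omega$. The Dirichlet-to-Neumann map $\Lambda:\mathbb{R}^B\to\mathbb{R}^B$ is $\Lambda f(x)=\sum_{y\in V}(u_f(x)-u_f(y))w_{xy}$ for $x\in B$. It is nonnegative and self-adjoint for $\langle f,g\rangle_B=\sum_{x\in B}f(x)g(x)$; its eigenvalues, counted with multiplicity, are $0=\sigma_1<\sigma_2\le\cdots\le\sigma_{|B|}$. The induced graph on $\Omega_1$ has vertex set $\Omega_1$ and the edges of $G$ with both endpoints in $\Omega_1$; it need not be connected. $\mu_2(\Omega_1)$ is the second smallest eigenvalue (with multiplicity) of its Laplacian $u\mapsto-\sum_{y\in\Omega_1}(u(y)-u(x))w_{xy}$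 on $\mathbb{R}^{\Omega_1}$. If $|\Omega_1|=1$, condition (3) is regarded as vacuously satisfied ($\mu_2(\Omega_1)=+\infty$). *)

(* Defs.v *)
From mathcomp Require Import all_boot all_order all_algebra.
From mathcomp Require Import boolp classical_sets reals.
From mathcomp Require Import polyrcf ring.

Set Implicit Arguments.
Unset Strict Implicit.
Unset Printing Implicit Defensive.

Import Order.TTheory GRing.Theory Num.Theory.
Local Open Scope ring_scope.

Section Eigenvalues.
Variables (R : realType) (I : finType).

(* Row i is the image of the i-th canonical basis vector, so that [opmx T]
   represents T acting on row vectors. *)
Definition opmx (T : {ffun I -> R} -> {ffun I -> R}) : 'M[R]_#|I| :=
  \matrix_(i, j) T [ffun x => (x == enum_val i)%:R] (enum_val j).

(* The real eigenvalues of a linear operator T on R^I, in nondecreasing order,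
   each repeated according to its multiplicity; [rootsR] is increasing and
   repetition-free. *)
Definition eigenvalues (T : {ffun I -> R} -> {ffun I -> R}) : seq R :=
  let p := char_poly (opmx T) in
  flatten [seq nseq (mup a p) a | a <- rootsR p].

(* [eigval T i] is the i-th smallest eigenvalue, counting from 1. *)
Definition eigval (T : {ffun I -> R} -> {ffun I -> R}) (i : nat) : R :=
  nth 0 (eigenvalues T) i.-1.

End Eigenvalues.

Definition connected_graph (V : finType) (e : rel V) : Prop :=
  [/\ symmetric e, irreflexive e & forall x y : V, connect e x y].

Definition boundary (V : finType) (e : rel V) (B : {set V}) : Prop :=
  [/\ B != finset.set0,
      {in B &, forall x y, ~~ e x y} &
      {in B, forall x, exists2 y, y \in ~: B & e x y}].

Definition edges_between (V : finType) (e : rel V) (S T : {set V}) :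
    {set {set V}} :=
  [set [set x; y] | x in S, y in T & e x y].

Definition induced (V : finType) (e : rel V) (S : {set V}) :
    rel {x : V | x \in S} :=
  fun x y => e (val x) (val y).

Section Operators.
Variables (R : realType) (V : finType) (e : rel V).

Definition weight (x y : V) : R := (e x y)%:R.

Definition laplacian (u : {ffun V -> R}) : {ffun V -> R} :=
  [ffun x => \sum_y (u y - u x) * weight x y].

Definition neg_laplacian (u : {ffun V -> R}) : {ffun V -> R} := - laplacian u.

Variable B : {set V}.

Definition harmonic_extension (f : {ffun {x : V | x \in B} -> R})
    (u : {ffun V -> R}) : Prop :=
  (forall b, u (val b) = f b) /\ {in ~: B, forall x, laplacian u x = 0}.

(* u_f; see [harm_extP] and [harmonic_extension_unique] below. *)
Definition harm_ext (f : {ffun {x : V | x \in B} -> R}) : {ffun V -> R} :=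
  xget 0 (harmonic_extension f).

Definition DtN (f : {ffun {x : V | x \in B} -> R}) :
    {ffun {x : V | x \in B} -> R} :=
  [ffun b => \sum_y (harm_ext f (val b) - harm_ext f y) * weight (val b) y].

Definition laplace_eigval (i : nat) : R := eigval neg_laplacian i.

Definition steklov_eigval (i : nat) : R := eigval DtN i.

Definition Omega : {set V} := ~: B.

Definition Omega0 : {set V} := [set x in Omega | [forall y in B, ~~ e x y]].

Definition Omega1 : {set V} := Omega :\: Omega0.

End Operators.

Section HarmonicExtension.
Variables (R : realType) (V : finType) (e : rel V) (B : {set V}).
Hypotheses (Ge : connected_graph e) (GB : boundary e B).

Lemma laplacianB (u v : {ffun V -> R}) :
  laplacian e (u - v) = laplacian e u - laplacian e v.
Proof.
apply/ffunP=> x; rewrite !ffunE -sumrB; apply: eq_bigr => y _.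
by rewrite !ffunE; ring.
Qed.

Lemma energyE (u : {ffun V -> R}) :
  \sum_x \sum_y (u y - u x) ^+ 2 * weight R e x y
    = - (\sum_x u x * laplacian e u x) *+ 2.
Proof.
have [esym _ _] := Ge.
rewrite mulr2n -[LHS]opprK -opprD; congr (- _).
rewrite -sumrN; under eq_bigr do rewrite -sumrN.
have -> : \sum_x u x * laplacian e u x
    = \sum_x \sum_y u x * (u y - u x) * weight R e x y.
  by apply: eq_bigr => x _; rewrite ffunE mulr_sumr; apply: eq_bigr => y _;
     rewrite mulrA.
rewrite [X in _ = _ + X]exchange_big -big_split; apply: eq_bigr => x _ /=.
rewrite -big_split; apply: eq_bigr => y _ /=.
rewrite [weight R e y x]/weight esym -/(weight R e x y).
ring.
Qed.

Lemma harmonic_vanishing (u : {ffun V -> R}) :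
  {in B, forall x, u x = 0} -> {in ~: B, forall x, laplacian e u x = 0} ->
  u = 0.
Proof.
move=> uB uO; have [esym _ econ] := Ge; have [/set0Pn[b bB] _ _] := GB.
have pos (x y : V) : 0 <= (u y - u x) ^+ 2 * weight R e x y.
  by rewrite mulr_ge0 ?sqr_ge0 ?ler0n.
have E0 : \sum_x \sum_y (u y - u x) ^+ 2 * weight R e x y = 0.
  rewrite energyE big1 ?oppr0 ?mul0rn // => x _.
  by have [/uB->|xB] := boolP (x \in B); rewrite ?mul0r // uO ?mulr0 ?inE.
have step x y : e x y -> u y = u x.
  move=> exy; apply/eqP; rewrite -subr_eq0 -sqrf_eq0.
  move/eqP: E0; rewrite psumr_eq0 => [/allP/(_ x)|? _]; last exact: sumr_ge0.
  rewrite mem_index_enum psumr_eq0 //= => /(_ isT)/allP/(_ y).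
  by rewrite mem_index_enum /weight exy mulr1 => /(_ isT).
apply/ffunP=> x; rewrite ffunE -(uB _ bB).
have /connectP[p] := econ b x; 
elim: p b {bB} => [|z p IH] b /=; first by move=> _ ->.
by move=> /andP[ebz pz] xl; rewrite (IH z pz xl) (step _ _ ebz).
Qed.

Lemma harmonic_extension_unique (f : {ffun {x : V | x \in B} -> R})
    (u v : {ffun V -> R}) :
  harmonic_extension e f u -> harmonic_extension e f v -> u = v.
Proof.
move=> [uf u0] [vf v0]; apply/eqP; rewrite -subr_eq0; apply/eqP.
apply: harmonic_vanishing => x xS.
  have := (uf (exist _ x xS), vf (exist _ x xS)).
  by rewrite !ffunE => -[-> ->]; rewrite subrr.
by rewrite laplacianB [LHS]ffunE u0 // add0r ffunE v0 ?oppr0.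
Qed.

Lemma harm_extP (f : {ffun {x : V | x \in B} -> R}) :
  harmonic_extension e f (harm_ext e f).
Proof.
apply: xgetPex.
pose fn (v : 'rV[R]_#|V|) : {ffun V -> R} := [ffun x => v 0 (enum_rank x)].
pose w x y := weight R e x y.
pose A : 'M[R]_#|V| := \matrix_(j, i)
  if enum_val i \in B then (j == i)%:R
  else w (enum_val i) (enum_val j)
       - (j == i)%:R * \sum_y w (enum_val i) y.
have AE v x : (v *m A) 0 (enum_rank x)
    = if x \in B then fn v x else laplacian e (fn v) x.
  rewrite mxE; under eq_bigr do rewrite mxE enum_rankK.
  case: ifP => xB.
    rewrite (bigD1 (enum_rank x)) //= eqxx mulr1 big1 ?addr0 ?ffunE //.
    by move=> i /negbTE->; rewrite mulr0.
  under eq_bigr do rewrite mulrBr; rewrite sumrB ffunE.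
  under [RHS]eq_bigr do rewrite mulrBl; rewrite sumrB; congr (_ - _).
    rewrite [RHS](reindex (@enum_val V V)) /=; last first.
      by apply: onW_bij; exact: enum_val_bij.
    by apply: eq_bigr => i _; rewrite ffunE enum_valK.
  rewrite (bigD1 (enum_rank x)) //= eqxx mul1r [X in _ + X]big1 ?addr0.
    by rewrite mulr_sumr; apply: eq_bigr => y _; rewrite [in RHS]ffunE.
  by move=> i /negbTE->; rewrite mul0r mulr0.
have Aunit : A \in unitmx.
  rewrite -row_free_unit; apply: inj_row_free => v vA.
  have fv0 : fn v = 0.
    apply: harmonic_vanishing => x; rewrite ?inE => xB; have := AE v x.
      by rewrite vA mxE xB.
    by rewrite vA mxE (negbTE xB).
  apply/rowP=> i; have /ffunP/(_ (enum_val i)) := fv0.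
  by rewrite !ffunE enum_valK mxE.
pose g : 'rV[R]_#|V| := \row_i oapp f 0 (insub (enum_val i)).
exists (fn (g *m invmx A)).
have gE x : g 0 (enum_rank x)
    = if x \in B then fn (g *m invmx A) x else laplacian e (fn (g *m invmx A)) x.
  by rewrite -AE mulmxKV.
split=> [b|x].
  by have := gE (val b); rewrite (valP b) => <-; rewrite mxE enum_rankK valK.
rewrite inE => /negbTE xB; have := gE x.
by rewrite xB => <-; rewrite mxE enum_rankK insubF.
Qed.

End HarmonicExtension.

(* Main.v *)
From HB Require Import structures.
Require Import Defs.
From mathcomp Require Import all_boot all_order all_algebra.
From mathcomp Require Import reals.
From mathcomp Require Import polyrcf complex ring lra zify spectral perm.
Import Order.TTheory GRing.Theory Num.Theory.
Local Open Scope ring_scope.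
Set Implicit Arguments.
Unset Strict Implicit.
Unset Printing Implicit Defensive.

(* Harmonic extension is energy preserving and does not decrease the norm, so
   min-max gives mu_i <= sigma_i. Equality for all i forces the harmonic
   extension of every mean-zero f on B to vanish on Omega (dimension count in
   each Steklov eigenspace); harmonicity of the extension of
   delta_b - delta_c is then condition (1), under which the Steklov operator is
   |Omega1| times the projection onto mean-zero functions. Hence
   sigma_2 = ... = sigma_|B| = |Omega1|, and given (1) the equality of the
   spectra amounts to mu_2 >= |Omega1|. The latter gives (2) and (3) by testing
   on functions vanishing on, respectively supported in, Omega1; conversely
   under (1) and (2) the graph is the join of its induced subgraphs on Omega1
   and B :|: Omega0, and its energy form splits accordingly. *)

(** * Real symmetric matrices *)

Section Spectral.
Variable R : realType.

Definition qform n (A : 'M[R]_n) (u : 'rV[R]_n) : R := (u *m A *m u^T) 0 0.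

Definition dot n (u v : 'rV[R]_n) : R := (u *m v^T) 0 0.

Lemma dotE n (u v : 'rV[R]_n) : dot u v = \sum_i u 0 i * v 0 i.
Proof. by rewrite /dot mxE; apply: eq_bigr => i _; rewrite mxE. Qed.

Lemma dotC n (u v : 'rV[R]_n) : dot u v = dot v u.
Proof. by rewrite !dotE; apply: eq_bigr => i _; rewrite mulrC. Qed.

Lemma dot_ge0 n (u : 'rV[R]_n) : 0 <= dot u u.
Proof. by rewrite dotE sumr_ge0 // => i _; rewrite -expr2 sqr_ge0. Qed.

Lemma dot_eq0 n (u : 'rV[R]_n) : (dot u u == 0) = (u == 0).
Proof.
apply/eqP/eqP => [|->]; last by rewrite /dot mul0mx mxE.
rewrite dotE => /eqP; rewrite psumr_eq0 => [/allP u0|i _]; last first.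
  by rewrite -expr2 sqr_ge0.
apply/rowP=> i; have := u0 i; rewrite mem_index_enum -expr2 sqrf_eq0 mxE.
by move/(_ isT)/eqP.
Qed.

Lemma dot_gt0 n (u : 'rV[R]_n) : (0 < dot u u) = (u != 0).
Proof. by rewrite lt_neqAle dot_ge0 andbT eq_sym dot_eq0. Qed.

Lemma dot_mulmx m n (M : 'M[R]_(m, n)) (u : 'rV_m) (v : 'rV_n) :
  dot (u *m M) v = dot u (v *m M^T).
Proof. by rewrite /dot trmx_mul trmxK mulmxA. Qed.

(** Over the complex numbers some eigenvector [x + i y] exists, with eigenvalue [a + i b]. Symmetry,
    in the form [dot (x A) y = dot x (y A)], gives [b (|x|^2 + |y|^2) = 0]; so [b = 0], and
    whichever of [x], [y] is nonzero is a real eigenvector. *)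
Lemma symmetric_eigenvector n (A : 'M[R]_n) : (0 < n)%N -> A^T = A ->
  exists (a : R) (v : 'rV_n), v != 0 /\ v *m A = a *: v.
Proof.
move=> n0 Asym.
have [z /eigenvalueP[v vA v0]] :=
  eigenvalue_closed (map_mx (real_complex R) A) n0.
pose x := map_mx (@complex.Re R) v; pose y := map_mx (@complex.Im R) v.
pose a := complex.Re z; pose b := complex.Im z.
have vA' j : \sum_k v 0 k * real_complex R (A k j) = z * v 0 j.
  by have /rowP/(_ j) := vA; rewrite !mxE => <-; apply: eq_bigr => k _; rewrite mxE.
have ReD : {morph @complex.Re R : s t / s + t >-> s + t} by case=> ? ? [].
have ImD : {morph @complex.Im R : s t / s + t >-> s + t} by case=> ? ? [].
have xA : x *m A = a *: x - b *: y.
  apply/rowP=> j; have /(congr1 (@complex.Re R)) := vA' j.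
  rewrite (big_morph _ ReD (erefl _)) !mxE => /eqP H; apply/eqP; move: H.
  congr (_ == _); last by rewrite /a /b; case: (z) (v 0 j) => ? ? [].
  by apply: eq_bigr => k _; rewrite mxE; case: (v 0 k) => p q /=; ring.
have yA : y *m A = b *: x + a *: y.
  apply/rowP=> j; have /(congr1 (@complex.Im R)) := vA' j.
  rewrite (big_morph _ ImD (erefl _)) !mxE => /eqP H; apply/eqP; move: H.
  congr (_ == _).
    by apply: eq_bigr => k _; rewrite mxE; case: (v 0 k) => p q /=; ring.
  by rewrite /a /b; case: (z) (v 0 j) => ? ? [? ?] /=; ring.
have b0 : b * (dot x x + dot y y) = 0.
  have : dot (x *m A) y = dot x (y *m A) by rewrite dot_mulmx Asym.
  rewrite xA yA !dotE mulrDr !mulr_sumr -big_split /= => /eqP.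
  rewrite -subr_eq0 -sumrB => /eqP H; apply/eqP; rewrite -oppr_eq0 -sumrN.
  by apply/eqP; rewrite -[RHS]H; apply: eq_bigr => k _; rewrite !mxE; ring.
have [x0|x0] := eqVneq x 0.
  have y0 : y != 0.
    apply: contraNneq v0 => y0; apply/eqP/rowP=> j; rewrite mxE.
    have /rowP/(_ j) := x0; have /rowP/(_ j) := y0; rewrite !mxE.
    by case: (v 0 j) => ? ? /= -> ->.
  exists a, y; split=> //; rewrite yA x0 scaler0 add0r //.
exists a, x; split=> //; rewrite xA.
have xy0 : dot x x + dot y y != 0.
  by rewrite gt_eqF // ltr_wpDr ?dot_ge0 ?dot_gt0.
by move/eqP: b0; rewrite mulf_eq0 (negbTE xy0) orbF => /eqP->; rewrite scale0r subr0.
Qed.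

(** The Householder reflection along [w = v - e] exchanges the unit vectors [e] and [v]; it
    degenerates only when [v = e], where the identity serves. *)
Lemma orthogonal_with_first_row n (v : 'rV[R]_(1 + n)) : dot v v = 1 ->
  exists2 H : 'M[R]_(1 + n), H *m H^T = 1%:M & row 0 H = v.
Proof.
move=> v1; pose e : 'rV[R]_(1 + n) := delta_mx 0 0.
have [w wE] : exists w, w = v - e by exists (v - e).
have [w0|w0] := eqVneq w 0.
  exists 1%:M; first by rewrite trmx1 mulmx1.
  by rewrite row1; apply/esym/eqP; rewrite -subr_eq0 -wE w0.
have ev : dot e v = v 0 0.
  rewrite dotE (bigD1 0) //= big1 ?mxE ?eqxx ?mul1r ?addr0 // => i /negbTE i0.
  by rewrite mxE eqxx i0 mul0r.
have ee : dot e e = 1.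
  by rewrite dotE (bigD1 0) //= big1 ?mxE ?eqxx ?mul1r ?addr0 // => i /negbTE i0;
     rewrite mxE eqxx i0 mul0r.
have dotB s t u : dot s (t - u) = dot s t - dot s u :> R.
  by rewrite /dot linearB /= mulmxBr !mxE.
have ww : dot w w = 2 * (1 - v 0 0).
  rewrite wE dotB ![dot (v - e) _]dotC !dotB [dot v e]dotC ev ee v1; ring.
have ew : dot e w = v 0 0 - 1 by rewrite wE dotB ev ee.
pose c := 2 / dot w w.
have wn : dot w w != 0 by rewrite dot_eq0.
pose H : 'M[R]_(1 + n) := 1%:M - c *: (w^T *m w).
have Hsym : H^T = H by rewrite /H linearB /= linearZ /= trmx_mul trmxK trmx1.
exists H.
  have XX : (c *: (w^T *m w)) *m (c *: (w^T *m w)) = (2 * c) *: (w^T *m w).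
    rewrite -scalemxAl -scalemxAr mulmxA -[w^T *m w *m w^T]mulmxA.
    rewrite [w *m w^T]mx11_scalar -/(dot w w) mul_mx_scalar -scalemxAl !scalerA.
    by congr (_ *: _); rewrite /c; field.
  rewrite Hsym /H mulmxBl mul1mx mulmxBr mulmx1 XX opprB.
  by rewrite mulr_natl mulr2n scalerDl addrK subrK.
rewrite rowE /H mulmxBr mulmx1 -scalemxAr mulmxA [delta_mx 0 0 *m w^T]mx11_scalar.
rewrite -/(dot e w) mul_scalar_mx scalerA ew /c ww.
have -> : 2 / (2 * (1 - v 0 0)) * (v 0 0 - 1) = -1.
  by field; move: wn; rewrite ww mulf_eq0 pnatr_eq0.
by rewrite scaleN1r opprK wE addrC subrK.
Qed.

(** Deflation: in an orthonormal basis starting with a unit eigenvector, [A] splits into its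
    eigenvalue and a smaller symmetric block, to which induction applies. *)
Lemma orthogonally_diagonalizable n (A : 'M[R]_n) : A^T = A ->
  exists (Q : 'M[R]_n) (d : 'rV_n),
    Q *m Q^T = 1%:M /\ Q *m A *m Q^T = diag_mx d.
Proof.
elim: n A => [|n IH] A Asym.
  by exists 1%:M, 0; split; apply/matrixP => -[].
have [a [v' [v'0 v'A]]] := symmetric_eigenvector (ltn0Sn n) Asym.
pose v := (Num.sqrt (dot v' v'))^-1 *: v'.
have s0 : Num.sqrt (dot v' v') != 0 by rewrite sqrtr_eq0 -ltNge dot_gt0.
have vv : dot v v = 1.
  rewrite /dot linearZ /= -scalemxAl -scalemxAr scalerA mxE -/(dot v' v').
  by rewrite -{3}[dot v' v']sqr_sqrtr ?dot_ge0 //; field.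
have vA : v *m A = a *: v by rewrite -scalemxAl v'A scalerA mulrC -scalerA.
have [H HH Hv] := orthogonal_with_first_row vv.
have H'H : H^T *m H = 1%:M by apply: mulmx1C.
have [M ME] : exists M : 'M[R]_(1 + n), M = H *m A *m H^T by eexists.
have Msym : M^T = M by rewrite ME !trmx_mul trmxK Asym mulmxA.
have M0 j : M 0 j = a * (0 == j)%:R.
  have : row 0 M = a *: row 0 1%:M.
    by rewrite ME !row_mul Hv vA -scalemxAl -Hv -row_mul HH.
  by move/rowP/(_ j); rewrite !mxE.
have l0 : lshift n 0 = 0 :> 'I_(1 + n) by apply: val_inj.
have Mb : M = block_mx a%:M 0 0 (drsubmx M).
  rewrite -[LHS]submxK; congr block_mx.
  - apply/matrixP=> i j; rewrite !ord1 !mxE.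
    by rewrite l0 M0 eqxx mulr1.
  - apply/matrixP=> i j; rewrite !ord1 !mxE.
    by rewrite l0 M0 mulr0.
  - apply/matrixP=> i j; rewrite !ord1 !mxE -Msym mxE.
    by rewrite l0 M0 mulr0.
have Ssym : (drsubmx M)^T = drsubmx M by rewrite -[RHS]/(drsubmx M) -{2}Msym trmx_drsub.
have [P [d [PP Pd]]] := IH _ Ssym.
have [Z ZE] : exists Z : 'M[R]_(1 + n), Z = block_mx 1%:M 0 0 P by eexists.
have ZT : Z^T = block_mx 1%:M 0 0 P^T by rewrite ZE tr_block_mx !trmx0 trmx1.
have QQ : (Z *m H) *m (Z *m H)^T = 1%:M.
  rewrite trmx_mul mulmxA -[Z *m H *m H^T]mulmxA HH mulmx1 ZT ZE mulmx_block.
  by rewrite !mulmx0 !mul0mx mulmx1 !addr0 add0r PP -scalar_mx_block.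
have QAQ : (Z *m H) *m (A : 'M[R]_(1 + n)) *m (Z *m H)^T
    = diag_mx (row_mx a%:M d).
  rewrite trmx_mul !mulmxA -[Z *m H *m A]mulmxA -[Z *m (H *m A) *m H^T]mulmxA.
  rewrite -ME Mb ZT ZE !mulmx_block !mulmx0 !mul0mx !mul1mx !mulmx1 !addr0.
  rewrite ?add0r ?mul0mx ?mulmx0 Pd diag_mx_row.
  by congr block_mx; apply/matrixP=> i j; rewrite !ord1 !mxE.
by exists (Z *m H), (row_mx a%:M d).
Qed.
End Spectral.

(** * Sorted eigenvalues as roots of the characteristic polynomial *)

Section Spectrum.
Variable R : realType.

(** The body of [eigenvalues] for an arbitrary polynomial, so that the eigenvalues of operators and
    of matrices agree by conversion. *)
Definition roots_with_mult (p : {poly R}) : seq R :=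
  flatten [seq nseq (mup a p) a | a <- rootsR p].

Lemma mup_prod_XsubC (x : R) (s : seq R) :
  mup x (\prod_(a <- s) ('X - a%:P)) = count_mem x s.
Proof.
elim: s => [|a s IH]; first by rewrite big_nil mupNroot // root1.
rewrite big_cons mupM ?polyXsubC_eq0 ?IH ?monic_neq0 ?monic_prod_XsubC //.
by rewrite -['X - a%:P]expr1 mup_XsubCX /=; case: eqP.
Qed.

(** Both lists are sorted, the left one being blocks of equal entries in increasing order, and each
    [x] occurs in both as often as its multiplicity as a root. *)
Lemma roots_with_mult_prod (s : seq R) :
  roots_with_mult (\prod_(a <- s) ('X - a%:P)) = sort <=%R s.
Proof.
set p := \prod_(a <- s) _.
have p0 : p != 0 by rewrite monic_neq0 ?monic_prod_XsubC.
apply: (@sorted_eq _ <=%R); [exact: le_trans|exact: le_anti| |exact: sort_le_sorted|].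
  have : sorted <%R (rootsR p) := sorted_roots _ _ _.
  rewrite /roots_with_mult !sorted_pairwise; [|exact: le_trans|exact: lt_trans].
  elim: (rootsR p) => //= a l IH /andP[/allP al pl].
  rewrite pairwise_cat IH // andbT; apply/andP; split.
    apply/allrelP=> x y /nseqP[-> _] /flatten_mapP[b bl /nseqP[-> _]].
    exact/ltW/al.
  by apply/(pairwiseP 0) => i j; rewrite !inE size_nseq => il jl _;
     rewrite !nth_nseq il jl.
rewrite perm_sym perm_sort perm_sym.
apply/allP=> x _ /=; apply/eqP; rewrite -[RHS]mup_prod_XsubC -/p.
rewrite /roots_with_mult count_flatten -map_comp sumnE big_map /=.
under eq_bigr => a _ do rewrite count_nseq /=.
have [xr|xr] := boolP (x \in rootsR p).
  rewrite (bigD1_seq x) ?uniq_roots //= eqxx mul1n big1 ?addn0 // => a /negbTE ax.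
  by rewrite ax.
rewrite mupNroot; last first.
  by apply: contraNN xr => xr; rewrite -(roots_on_rootsR p0) xr inE.
rewrite big1_seq // => a /= ar; case: eqP => // ax.
by rewrite -ax ar in xr.
Qed.

Definition mx_eigenvalues n (A : 'M[R]_n) : seq R := roots_with_mult (char_poly A).

Lemma char_poly_similar n (P A : 'M[R]_n) : P \in unitmx ->
  char_poly (P *m A *m invmx P) = char_poly A.
Proof.
move=> Pu; rewrite /char_poly.
have -> : char_poly_mx (P *m A *m invmx P)
    = map_mx polyC P *m char_poly_mx A *m map_mx polyC (invmx P).
  rewrite /char_poly_mx mulmxBr mulmxBl -!map_mxM /= mul_mx_scalar -scalemxAl.
  by rewrite -map_mxM /= mulmxV // map_mx1 scalemx1.
by rewrite !det_mulmx mulrAC -det_mulmx -map_mxM /= mulmxV // map_mx1 det1 mul1r.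
Qed.

(** Orthogonal diagonalization yields the eigenvalues in some order on the diagonal. The
    characteristic polynomial identifies their sorted list with [mx_eigenvalues A], and permuting
    the rows of the orthogonal matrix sorts the diagonal. *)
Theorem spectral_theorem n (A : 'M[R]_n) : A^T = A ->
  [/\ size (mx_eigenvalues A) = n, sorted <=%R (mx_eigenvalues A)
    & exists Q : 'M[R]_n, Q *m Q^T = 1%:M
        /\ Q *m A *m Q^T = diag_mx (\row_i (mx_eigenvalues A)`_i)].
Proof.
move=> Asym; have [P [d [PP PA]]] := orthogonally_diagonalizable Asym.
have [Pu _] := mulmx1_unit PP.
have PV : invmx P = P^T by rewrite -[LHS]mulmx1 -PP mulKmx.
have Eeig : mx_eigenvalues A = sort <=%R [seq d 0 i | i <- enum 'I_n].
  rewrite /mx_eigenvalues -(char_poly_similar A Pu) PV PA.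
  rewrite char_poly_trig ?diag_mx_is_trig // -roots_with_mult_prod.
  by rewrite big_map big_enum /=; congr roots_with_mult; apply: eq_bigr => i _;
     rewrite mxE eqxx mulr1n.
set s := mx_eigenvalues A in Eeig *.
have ssz : size s = n by rewrite Eeig size_sort size_map size_enum_ord.
split=> //; first by rewrite Eeig sort_le_sorted.
have /tuple_permP[p sp] : perm_eq s [tuple d 0 i | i < n].
  by rewrite Eeig perm_sort.
exists (row_perm p P).
have rr (M : 'M[R]_n) : row_perm p P *m M *m (row_perm p P)^T
    = row_perm p (col_perm p (P *m M *m P^T)).
  by rewrite [row_perm p P]row_permE [RHS]row_permE col_permE trmx_mul tr_perm_mx !mulmxA.
split.
  rewrite -[X in X *m _]mulmx1 rr mulmx1 PP.
  by apply/matrixP=> i j; rewrite !mxE (inj_eq perm_inj).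
rewrite rr PA; apply/matrixP=> i j; rewrite !mxE (inj_eq perm_inj) sp.
by rewrite (nth_map i) ?size_enum_ord // !tnth_map tnth_ord_tuple nth_ord_enum.
Qed.

End Spectrum.

(** * Variational estimates *)

Section Rayleigh.
Variable R : realType.

Lemma dot_orthogonal n (Q : 'M[R]_n) (c c' : 'rV_n) : Q *m Q^T = 1%:M ->
  dot (c *m Q) (c' *m Q) = dot c c'.
Proof. by move=> QQ; rewrite dot_mulmx -mulmxA QQ mulmx1. Qed.

Lemma qform_orthogonal n (A Q : 'M[R]_n) (d c : 'rV_n) :
  Q *m A *m Q^T = diag_mx d -> qform A (c *m Q) = \sum_i d 0 i * c 0 i ^+ 2.
Proof.
move=> QAQ; rewrite /qform trmx_mul !mulmxA -[c *m Q *m A]mulmxA.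
rewrite -[c *m _ *m Q^T]mulmxA QAQ -/(dot _ _) dotE mul_mx_diag.
by apply: eq_bigr => i _; rewrite !mxE; ring.
Qed.

Lemma coordinates n (Q : 'M[R]_n) (u : 'rV_n) : Q *m Q^T = 1%:M ->
  u = u *m Q^T *m Q.
Proof. by move/mulmx1C => QQ; rewrite -mulmxA QQ mulmx1. Qed.

Lemma sorted_nth_le (s : seq R) (i j : nat) :
  sorted <=%R s -> (i <= j)%N -> (j < size s)%N -> s`_i <= s`_j.
Proof.
move=> ss ij js; apply: (sorted_leq_nth le_trans le_refl) => //.
by rewrite inE (leq_ltn_trans ij).
Qed.

(** If the second eigenvalue is positive, the kernel vector [e] has only its first eigen-coordinate
    nonzero. A vector orthogonal to [e] thus has no first coordinate, and every eigenvalue it meets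
    is at least [t]. *)
Lemma eigenvalue_gap n (A : 'M[R]_n) (e : 'rV_n) (t : R) : A^T = A ->
  (forall u, 0 <= qform A u) -> e *m A = 0 -> e != 0 ->
  t <= (mx_eigenvalues A)`_1 ->
  forall u, dot u e = 0 -> t * dot u u <= qform A u.
Proof.
move=> Asym pos eA e0 t1 u ue; have [ssz ssort [Q [QQ QAQ]]] := spectral_theorem Asym.
set s := mx_eigenvalues A in t1 ssz ssort QAQ.
(* Here [t <= 0] and positivity of the form suffices; this also covers [n <= 1], where the entry of
   index 1 is the default 0. *)
have [s1|s1] := lerP s`_1 0.
  apply: le_trans (pos u); rewrite mulr_le0_ge0 ?dot_ge0 //; exact: le_trans s1.
have [ce ceE] : exists c, c = e *m Q^T by eexists.
have [c cE] : exists c, c = u *m Q^T by eexists.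
have n1 : (1 < n)%N.
  by rewrite -ssz ltnNge; apply: contraTN s1 => ?; rewrite nth_default // ltxx.
have ce0 (i : 'I_n) : (0 < i)%N -> ce 0 i = 0.
  move=> i0; have : ce *m diag_mx (\row_i s`_i) = 0.
    by rewrite -QAQ ceE !mulmxA -[e *m Q^T *m Q]mulmxA (mulmx1C QQ) mulmx1 eA mul0mx.
  move/rowP/(_ i); rewrite mul_mx_diag !mxE => /eqP; rewrite mulf_eq0 => /orP[/eqP//|].
  by rewrite gt_eqF // (lt_le_trans s1) // sorted_nth_le // ssz.
pose z : 'I_n := Ordinal (ltnW n1).
have nz (i : 'I_n) : i != z -> (0 < i)%N by rewrite lt0n.
have cez : ce 0 z != 0.
  apply: contraNneq e0 => cez; rewrite (coordinates e QQ) -ceE.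
  rewrite (_ : ce = 0) ?mul0mx //; apply/rowP=> i; rewrite [RHS]mxE.
  by have [->//|/nz/ce0] := eqVneq i z.
have cz : c 0 z = 0.
  move: ue; rewrite (coordinates u QQ) (coordinates e QQ) -ceE -cE dot_orthogonal //.
  rewrite dotE (bigD1 z) //= big1 ?addr0 => [/eqP|i /nz/ce0->]; last by rewrite mulr0.
  by rewrite mulf_eq0 (negbTE cez) orbF => /eqP.
rewrite (coordinates u QQ) -cE dot_orthogonal // (qform_orthogonal _ QAQ) dotE.
rewrite mulr_sumr ler_sum // => i _; rewrite mxE -expr2.
have [->|/nz i0] := eqVneq i z; first by rewrite cz expr0n /= !mulr0.
by rewrite ler_wpM2r ?sqr_ge0 // (le_trans t1) // sorted_nth_le // ssz.
Qed.

(** The span of the first two eigenvectors has dimension 2, hence contains a nonzero vector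
    orthogonal to [e], and the Rayleigh quotient there is at most the second eigenvalue. *)
Lemma second_eigenvalue_ge n (A : 'M[R]_n) (e : 'rV_n) (t : R) : A^T = A ->
  (1 < n)%N -> (forall u, dot u e = 0 -> t * dot u u <= qform A u) ->
  t <= (mx_eigenvalues A)`_1.
Proof.
move=> Asym n1 H; have [ssz ssort [Q [QQ QAQ]]] := spectral_theorem Asym.
set s := mx_eigenvalues A in ssz ssort QAQ *.
pose z : 'I_n := Ordinal (ltnW n1); pose o : 'I_n := Ordinal n1.
have zo : z != o by [].
have [ce ceE] : exists c, c = e *m Q^T by eexists.
(* The coefficients of that vector: one linear equation in two unknowns. *)
have [p [q [pq0 pq]]] : exists p q : R,
    p * ce 0 z + q * ce 0 o = 0 /\ 0 < p ^+ 2 + q ^+ 2.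
  have [c0|c0] := eqVneq (ce 0 z) 0.
    by exists 1, 0; rewrite c0; split; [ring|rewrite expr0n expr1n addr0 ltr01].
  exists (- ce 0 o), (ce 0 z); split; first by ring.
  by rewrite ltr_wpDl ?sqr_ge0 // exprn_even_gt0.
pose c : 'rV[R]_n := \row_i (if i == z then p else if i == o then q else 0).
have sum2 (F : 'I_n -> R) : (forall i, i != z -> i != o -> F i = 0) ->
    \sum_i F i = F z + F o.
  move=> F0; rewrite (bigD1 z) //= (bigD1 o) 1?eq_sym //= big1 ?addr0 //.
  by move=> i /andP[? ?]; exact: F0.
have cz : c 0 z = p by rewrite mxE eqxx.
have co : c 0 o = q by rewrite mxE eqxx eq_sym (negbTE zo).
have c0 i : i != z -> i != o -> c 0 i = 0 by rewrite mxE => /negbTE-> /negbTE->.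
have := H (c *m Q); rewrite {1}(coordinates e QQ) -ceE !dot_orthogonal //.
rewrite (qform_orthogonal _ QAQ) !dotE !sum2 => [|i iz io|i iz io|i iz io];
  try by rewrite c0 // ?expr0n /= ?mulr0 ?mul0r.
rewrite !mxE !eqxx [o == z]eq_sym (negbTE zo) /= => /(_ pq0) le2.
have s01 : s`_0 <= s`_1 by rewrite sorted_nth_le ?ssz.
rewrite -(ler_pM2r pq); apply: le_trans (_ : s`_0 * p ^+ 2 + s`_1 * q ^+ 2 <= _).
  by rewrite !expr2 in le2 *.
by rewrite mulrDr lerD2r ler_wpM2r ?sqr_ge0.
Qed.

Lemma eigenvalue_eigenvector n (A : 'M[R]_n) (k : 'I_n) : A^T = A ->
  exists v : 'rV_n, dot v v = 1 /\ qform A v = (mx_eigenvalues A)`_k.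
Proof.
move=> Asym; have [ssz ssort [Q [QQ QAQ]]] := spectral_theorem Asym.
exists (delta_mx 0 k *m Q).
split.
  rewrite dot_orthogonal // dotE (bigD1 k) //= big1 => [|i /negbTE ik].
    by rewrite !mxE !eqxx mulr1 addr0.
  by rewrite !mxE ik mulr0.
rewrite (qform_orthogonal _ QAQ) (bigD1 k) //= big1 => [|i /negbTE ik].
  by rewrite !mxE !eqxx expr1n mulr1 addr0.
by rewrite !mxE ik expr0n mulr0.
Qed.

(** The smallest eigenvalue is a value of a nonnegative form, and times [|e|^2] it is at most the
    value 0 of the form at [e]. *)
Lemma first_eigenvalue_eq0 n (A : 'M[R]_n) (e : 'rV_n) : A^T = A ->
  (forall u, 0 <= qform A u) -> e *m A = 0 -> e != 0 ->
  (mx_eigenvalues A)`_0 = 0.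
Proof.
move=> Asym pos eA e0; have [ssz ssort [Q [QQ QAQ]]] := spectral_theorem Asym.
set s := mx_eigenvalues A in ssz ssort QAQ *.
have [n0|n0] := posnP n; first by rewrite nth_default // ssz n0.
apply/eqP; rewrite eq_le; apply/andP; split; last first.
  by have [v [_ <-]] := eigenvalue_eigenvector (Ordinal n0) Asym.
have H : s`_0 * dot e e <= 0.
  rewrite [X in _ <= X](_ : _ = qform A e); last by rewrite /qform eA mul0mx mxE.
  rewrite (coordinates e QQ); move: (e *m Q^T) => c.
  rewrite dot_orthogonal // (qform_orthogonal _ QAQ) dotE.
  rewrite mulr_sumr ler_sum // => i _; rewrite mxE -expr2.
  by rewrite ler_wpM2r ?sqr_ge0 // sorted_nth_le // ssz.
by move: H; rewrite pmulr_lle0 // dot_gt0.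
Qed.

Definition basis_rows n (p : {set 'I_n}) : 'M[R]_(#|p|, n) :=
  rowsub (@enum_val _ (mem p)) 1%:M.

Lemma mul_basis_rowsT m n (M : 'M[R]_(m, n)) (p : {set 'I_n}) :
  M *m (basis_rows p)^T = colsub (@enum_val _ (mem p)) M.
Proof. by rewrite /basis_rows trmx_mxsub trmx1 mulmx_colsub mulmx1. Qed.

Lemma row_free_basis_rows n (p : {set 'I_n}) : row_free (basis_rows p).
Proof.
apply/row_freeP; exists (basis_rows p)^T; rewrite mul_basis_rowsT.
by apply/matrixP=> i j; rewrite !mxE (inj_eq enum_val_inj).
Qed.

Lemma sub_basis_rows n (p : {set 'I_n}) (c : 'rV_n) :
  (c <= basis_rows p)%MS <-> (forall i, i \notin p -> c 0 i = 0).
Proof.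
split=> [/submxP[D ->] i ip|c0].
  rewrite mxE big1 // => k _; rewrite !mxE; case: eqP => [ki|]; rewrite ?mulr0 //.
  by rewrite -ki enum_valP in ip.
apply/submxP; exists (c *m (basis_rows p)^T).
apply/rowP=> i; rewrite mul_basis_rowsT mxE.
have [ip|ip] := boolP (i \in p).
  rewrite (bigD1 (enum_rank_in ip i)) //= !mxE enum_rankK_in // eqxx mulr1.
  rewrite big1 ?addr0 // => k ki; rewrite !mxE; case: eqP => [kE|]; rewrite ?mulr0 //.
  by case/eqP: ki; apply: enum_val_inj; rewrite enum_rankK_in // kE.
rewrite c0 // big1 // => k _; rewrite !mxE; case: eqP => [ki|]; rewrite ?mulr0 //.
by rewrite -ki enum_valP in ip.
Qed.

(** Dimension count: the vectors supported on [p] form a space of dimension [#|p|], on which the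
    coordinates in [q] impose [#|q|] linear conditions. The left kernel of the matrix [N] of these
    conditions is the required space. *)
Lemma constrained_subspace m n (M : 'M[R]_(m, n)) (p : {set 'I_m}) (q : {set 'I_n}) :
  exists Y : 'M[R]_(#|p|, m), (#|p| - #|q| <= \rank Y)%N /\
    forall c : 'rV_m, (c <= Y)%MS ->
      (forall i, i \notin p -> c 0 i = 0)
      /\ (forall j, j \in q -> (c *m M) 0 j = 0).
Proof.
have [N NE] : exists N, N = basis_rows p *m M *m (basis_rows q)^T by eexists.
exists (kermx N *m basis_rows p); split.
  rewrite mxrankMfree ?row_free_basis_rows // mxrank_ker.
  by rewrite leq_sub2l // rank_leq_col.
move=> c cY; split=> [|j jq].
  by apply/sub_basis_rows; apply: submx_trans cY _; exact: submxMl.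
have /submxP[D cE] := cY.
have : c *m M *m (basis_rows q)^T = 0.
  have kN : kermx N *m basis_rows p *m M *m (basis_rows q)^T = 0.
    by rewrite -2!(mulmxA (kermx N)) -NE mulmx_ker.
  by rewrite cE -2!(mulmxA D) kN mulmx0.
by rewrite mul_basis_rowsT => /rowP/(_ (enum_rank_in jq j)); rewrite !mxE enum_rankK_in.
Qed.

End Rayleigh.

(** * Comparison of two spectra along a form-preserving map that does not decrease norms *)

Section Comparison.
Variables (R : realType) (m n r : nat).
Variables (S : 'M[R]_m) (A : 'M[R]_n) (P : 'M[R]_(m, n)) (K : 'M[R]_(m, r)).
Hypotheses (Ssym : S^T = S) (Asym : A^T = A).
Hypothesis Spos : forall f, 0 <= qform S f.
Hypothesis qformP : forall f, qform A (f *m P) = qform S f.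
Hypothesis dotP : forall f,
  dot (f *m P) (f *m P) = dot f f + dot (f *m K) (f *m K).

(** Min-max: among the combinations of the first [k + 1] eigenvectors of [S], some nonzero [f] has
    [f P] orthogonal to the first [k] eigenvectors of [A]. Then [a_k |fP|^2 <= qform S f <= s_k
    |f|^2 <= s_k |fP|^2], the last step by [dotP] and [0 <= s_k]. *)
Lemma eigenvalue_compression_le (k : nat) : (k < m)%N -> (k < n)%N ->
  (mx_eigenvalues A)`_k <= (mx_eigenvalues S)`_k.
Proof.
move=> km kn; have [asz asort [Q [QQ QAQ]]] := spectral_theorem Asym.
have [ssz ssort [W [WW WSW]]] := spectral_theorem Ssym.
set a := mx_eigenvalues A in asz asort QAQ *.
set s := mx_eigenvalues S in ssz ssort WSW *.
pose p : {set 'I_m} := [set i : 'I_m | (i <= k)%N].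
pose q : {set 'I_n} := [set j : 'I_n | (j < k)%N].
have [Y [Yr Yc]] := constrained_subspace (W *m P *m Q^T) p q.
have pcard : #|p| = k.+1.
  have -> : p = [set widen_ord km i | i : 'I_k.+1].
    apply/setP=> i; rewrite inE; apply/idP/imsetP => [ik|[j _ ->]].
      by exists (Ordinal (ik : (i < k.+1)%N)) => //; exact: val_inj.
    by rewrite /= -ltnS.
  rewrite card_imset ?card_ord // => i j /(congr1 val) /= ij; exact: val_inj.
have qcard : #|q| = k.
  have -> : q = [set widen_ord (ltnW kn) i | i : 'I_k].
    apply/setP=> i; rewrite inE; apply/idP/imsetP => [ik|[j _ ->]].
      by exists (Ordinal ik) => //; exact: val_inj.
    by rewrite /=.
  rewrite card_imset ?card_ord // => i j /(congr1 val) /= ij; exact: val_inj.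
have Y0 : Y != 0.
  by rewrite -mxrank_eq0 -lt0n (leq_trans _ Yr) // pcard qcard subSnn.
have /rowV0Pn[c cY c0] := Y0.
have [cp cq] := Yc c cY.
have [f fE] : exists f, f = c *m W by eexists.
have [x xE] : exists x, x = f *m P *m Q^T by eexists.
have ff : dot f f = dot c c by rewrite fE dot_orthogonal.
have uu : dot (f *m P) (f *m P) = dot x x.
  by rewrite (coordinates (f *m P) QQ) -xE dot_orthogonal.
have x0 (j : 'I_n) : (j < k)%N -> x 0 j = 0.
  by move=> jk; rewrite xE fE -(cq j) ?inE // !mulmxA.
have low : a`_k * dot x x <= qform S f.
  rewrite -qformP (coordinates (f *m P) QQ) -xE (qform_orthogonal _ QAQ) dotE.
  rewrite mulr_sumr ler_sum // => j _; rewrite mxE -expr2.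
  have [jk|jk] := ltnP j k; first by rewrite x0 // expr0n !mulr0.
  by rewrite ler_wpM2r ?sqr_ge0 // sorted_nth_le // asz.
have up : qform S f <= s`_k * dot c c.
  rewrite fE (qform_orthogonal _ WSW) dotE mulr_sumr ler_sum // => i _.
  rewrite mxE -expr2; have [ik|ik] := leqP i k.
    by rewrite ler_wpM2r ?sqr_ge0 // sorted_nth_le // ssz.
  by rewrite cp ?expr0n ?mulr0 // inE -ltnNge.
have sk0 : 0 <= s`_k.
  by have [v [_ <-]] := eigenvalue_eigenvector (Ordinal km) Ssym.
have cc : 0 < dot c c by rewrite dot_gt0.
have xc : dot c c <= dot x x by rewrite -uu -ff dotP lerDl dot_ge0.
have xx : 0 < dot x x by exact: lt_le_trans xc.
rewrite -(ler_pM2r xx) (le_trans low) // (le_trans up) //.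
by rewrite ler_wpM2l.
Qed.

Hypothesis mn : (m <= n)%N.
Hypothesis eigE : forall k, (k < m)%N ->
  (mx_eigenvalues S)`_k = (mx_eigenvalues A)`_k.

(* Let [t] be the eigenvalue of index [k]. The combinations of eigenvectors of
   [S] with eigenvalue at most [t] whose image is orthogonal to the
   eigenvectors of [A] below [t] form a space of dimension at least the
   multiplicity of [t], and are all [t]-eigenvectors; so they exhaust the
   eigenspace, and [t |fP|^2 <= t |f|^2] there. *)
Lemma eigenvector_defect0 (W : 'M[R]_m) (k : 'I_m) : W *m W^T = 1%:M ->
  W *m S *m W^T = diag_mx (\row_i (mx_eigenvalues S)`_i) ->
  0 < (mx_eigenvalues S)`_k -> row k W *m K = 0.
Proof.
move=> WW WSW t0; have [asz asort [Q [QQ QAQ]]] := spectral_theorem Asym.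
have [ssz ssort _] := spectral_theorem Ssym.
move: (mx_eigenvalues S) (mx_eigenvalues A) eigE => s a sa
  in ssz ssort WSW asz asort QAQ t0 *.
set t := s`_k in t0 *.
pose p : {set 'I_m} := [set i : 'I_m | s`_i <= t].
pose pe : {set 'I_m} := [set i : 'I_m | s`_i == t].
pose pl : {set 'I_m} := [set i : 'I_m | s`_i < t].
pose q : {set 'I_n} := [set j : 'I_n | a`_j < t].
have [Y [Yr Yc]] := constrained_subspace (W *m P *m Q^T) p q.
have key c : (c <= Y)%MS ->
    t * dot (c *m W *m P) (c *m W *m P) <= qform S (c *m W) /\
    qform S (c *m W) <= t * dot c c /\ (c <= basis_rows R pe)%MS.
  move=> cY; have [cp cq] := Yc c cY.
  have [f fE] : exists f, f = c *m W by eexists.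
  have [x xE] : exists x, x = f *m P *m Q^T by eexists.
  rewrite -fE.
  have ff : dot f f = dot c c by rewrite fE dot_orthogonal.
  have uu : dot (f *m P) (f *m P) = dot x x.
    by rewrite (coordinates (f *m P) QQ) -xE dot_orthogonal.
  have low : t * dot x x <= qform S f.
    rewrite -qformP (coordinates (f *m P) QQ) -xE (qform_orthogonal _ QAQ) dotE.
    rewrite mulr_sumr ler_sum // => j _; rewrite mxE -expr2.
    have [jt|jt] := ltP a`_j t; last by rewrite ler_wpM2r ?sqr_ge0.
    have -> : x 0 j = 0 by rewrite xE fE -(cq j) ?inE // !mulmxA.
    by rewrite expr0n !mulr0.
  have SfE : qform S f = \sum_(i < m) s`_i * c 0 i ^+ 2.
    by rewrite fE (qform_orthogonal _ WSW); apply: eq_bigr => i _; rewrite mxE.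
  have pos (i : 'I_m) : 0 <= (t - s`_i) * c 0 i ^+ 2.
    have [it|it] := leP s`_i t; first by rewrite mulr_ge0 ?sqr_ge0 ?subr_ge0.
    by rewrite cp ?inE -?ltNge // expr0n mulr0.
  have gapE : t * dot c c - qform S f = \sum_(i < m) (t - s`_i) * c 0 i ^+ 2.
    rewrite SfE dotE mulr_sumr -sumrB; apply: eq_bigr => i _; ring.
  have up : qform S f <= t * dot c c.
    by rewrite -subr_ge0 gapE sumr_ge0.
  split; [by rewrite uu|split=> //].
  (* As [|f| <= |fP|], the bounds [low] and [up] are equalities; a sum of nonnegative terms
     vanishes, so [c] lives on the indices with eigenvalue exactly [t]. *)
  have gap0 : \sum_(i < m) (t - s`_i) * c 0 i ^+ 2 = 0.
    apply/eqP; rewrite eq_le sumr_ge0 // -gapE subr_le0 andbT.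
    by apply: le_trans low; rewrite ler_pM2l // -uu -ff dotP lerDl dot_ge0.
  apply/sub_basis_rows => i; rewrite inE => it.
  move/eqP: gap0; rewrite psumr_eq0 => [/allP/(_ i)|j _]; last exact: pos.
  rewrite mem_index_enum /= mulf_eq0 sqrf_eq0 subr_eq0 eq_sym (negbTE it) /=.
  by move/(_ isT)/eqP.
have card_p : #|p| = (#|pl| + #|pe|)%N.
  have pI : pl :&: pe = finset.set0.
    by apply/setP=> i; rewrite !inE; case: ltgtP.
  rewrite -cardsUI pI cards0 addn0; congr #|pred_of_set _|.
  by apply/setP=> i; rewrite !inE le_eqVlt orbC.
(* An eigenvalue of [A] below [t] has index below [k], because the list is sorted and its entry of
   index [k] is [t]; at such indices the two spectra agree. *)
have card_q : (#|q| <= #|pl|)%N.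
  have -> : q = [set widen_ord mn i | i in pl].
    apply/setP=> j; rewrite inE; apply/idP/imsetP => [jt|[i + ->]]; last first.
      by rewrite inE /= -sa.
    have jk : (j < k)%N.
      rewrite ltnNge; apply: contraTN jt => kj; rewrite -leNgt /t sa //.
      by rewrite sorted_nth_le // asz.
    have jm := ltn_trans jk (ltn_ord k).
    exists (Ordinal jm); last exact: val_inj.
    by rewrite inE /= sa.
  exact: leq_imset_card.
have Ype : (Y <= basis_rows R pe)%MS.
  by apply/row_subP=> i; have [_ []] := key _ (row_sub i Y).
(* The inclusion [Ype] is an equality, since the rank of [Y] is at least [#|p| - #|q| >= #|pe|]. *)
have peY : (basis_rows R pe <= Y)%MS.
  have := mxrank_leqif_sup Ype; case=> + <- => le; rewrite eqn_leq le /=.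
  apply: leq_trans Yr; have /eqP -> := row_free_basis_rows R pe.
  by rewrite card_p leq_subRL; lia.
have ckY : ((delta_mx 0 k : 'rV_m) <= Y)%MS.
  apply: submx_trans peY; apply/sub_basis_rows => i; rewrite inE mxE => it.
  by rewrite eqxx; case: eqP => // ik; rewrite ik eqxx in it.
have [low [up _]] := key _ ckY.
(* For the eigenvector itself this reads [t (|f|^2 + |fK|^2) <= t |f|^2] with [t > 0], so
   [f K = 0]. *)
have := le_trans low up; rewrite -rowE dotP.
have -> : dot (row k W) (row k W) = dot (delta_mx 0 k : 'rV_m) (delta_mx 0 k).
  by rewrite rowE dot_orthogonal.
rewrite ler_pM2l // gerDl => le0; apply/eqP; rewrite -dot_eq0.
by rewrite eq_le le0 dot_ge0.
Qed.

(** Expand [f] in eigenvectors of [S]: [K] kills those with positive eigenvalue, and those with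
    eigenvalue 0 are multiples of [e], on which [f] has coefficient 0. *)
Lemma defect0 (e : 'rV[R]_m) :
  (forall f : 'rV_m, qform S f = 0 -> exists b, f = b *: e) ->
  forall f : 'rV_m, dot f e = 0 -> f *m K = 0.
Proof.
move=> ker f fe; have [ssz ssort [W [WW WSW]]] := spectral_theorem Ssym.
have [c cE] : exists c, c = f *m W^T by eexists.
rewrite (coordinates f WW) -cE [c *m W]mulmx_sum_row mulmx_suml big1 // => i _.
rewrite -scalemxAl.
have [v [vv vS]] : exists v : 'rV_m, v = row i W /\ qform S v = (mx_eigenvalues S)`_i.
  exists (row i W); split=> //; rewrite rowE (qform_orthogonal _ WSW).
  rewrite (bigD1 i) //= big1 => [|j /negbTE ij].
    by rewrite !mxE !eqxx expr1n mulr1 addr0.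
  by rewrite !mxE ij expr0n mulr0.
have [s0|s0] := ltP 0 (mx_eigenvalues S)`_i.
  by rewrite (eigenvector_defect0 WW WSW) // scaler0.
have si : qform S v = 0 by apply/eqP; rewrite eq_le Spos vS s0.
have [b vb] := ker _ si.
have -> : c 0 i = dot f v.
  by rewrite cE vv dotE mxE; apply: eq_bigr => j _; rewrite !mxE.
by rewrite vb /dot linearZ /= -scalemxAr mxE -/(dot f e) fe mulr0 scale0r.
Qed.
End Comparison.

(** * Transfer from matrices to operators on finite function spaces *)

Section FunctionRows.
Variable R : realType.
Implicit Types I J : finType.

Definition inner I (u v : {ffun I -> R}) : R := \sum_x u x * v x.

Definition rowf I (u : {ffun I -> R}) : 'rV[R]_#|I| := \row_i u (enum_val i).

Definition frow I (v : 'rV[R]_#|I|) : {ffun I -> R} := [ffun x => v 0 (enum_rank x)].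

(** Extends [opmx] to maps between different function spaces, and is convertible to it when [I] and
    [J] coincide. *)
Definition fmx I J (T : {ffun I -> R} -> {ffun J -> R}) : 'M[R]_(#|I|, #|J|) :=
  \matrix_(i, j) T [ffun x => (x == enum_val i)%:R] (enum_val j).

Lemma frowK I : cancel (@frow I) (@rowf I).
Proof. by move=> v; apply/rowP=> i; rewrite !mxE ffunE enum_valK. Qed.

Lemma sum_enum_val I (F : I -> R) : \sum_x F x = \sum_(i < #|I|) F (enum_val i).
Proof. by rewrite (reindex (@enum_val I I)) //=; apply: onW_bij; exact: enum_val_bij. Qed.

Lemma dot_rowf I (u v : {ffun I -> R}) : dot (rowf u) (rowf v) = inner u v.
Proof. by rewrite dotE /inner [RHS]sum_enum_val; apply: eq_bigr => i _; rewrite !mxE. Qed.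

Lemma innerC I (u v : {ffun I -> R}) : inner u v = inner v u.
Proof. by apply: eq_bigr => x _; rewrite mulrC. Qed.

Lemma inner_delta I (u : {ffun I -> R}) (x : I) :
  inner u [ffun y => (y == x)%:R] = u x.
Proof.
rewrite /inner (bigD1 x) //= ffunE eqxx mulr1 big1 ?addr0 // => y /negbTE yx.
by rewrite ffunE yx mulr0.
Qed.

(* [{ffun I -> R}] only carries a module structure over [R] through [R^o]. *)
Definition flinear I J (T : {ffun I -> R} -> {ffun J -> R}) : Prop :=
  forall a (u v : {ffun I -> R}),
    T [ffun x => a * u x + v x] = [ffun x => a * T u x + T v x].

Lemma rowf_fmx I J (T : {ffun I -> R} -> {ffun J -> R}) (u : {ffun I -> R}) :
  flinear T -> rowf u *m fmx T = rowf (T u).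
Proof.
(* Conjugated to row vectors, [T] becomes a bundled linear map, whose matrix is then available. *)
move=> Tlin; pose G (v : 'rV[R]_#|I|) := rowf (T (frow v)).
have Glin : linear G.
  move=> a v w; rewrite /G.
  have -> : frow (a *: v + w) = [ffun x => a * frow v x + frow w x].
    by apply/ffunP=> x; rewrite !ffunE !mxE.
  by rewrite Tlin; apply/rowP=> j; rewrite !mxE ffunE.
pose G' : {linear 'rV[R]_#|I| -> 'rV[R]_#|J|} :=
  HB.pack G (GRing.isLinear.Build _ _ _ _ G Glin).
have -> : fmx T = lin1_mx G'.
  apply/matrixP=> i j; rewrite !mxE; congr (T _ _).
  by apply/ffunP=> x; rewrite !ffunE mxE eqxx (can2_eq enum_rankK enum_valK).
rewrite mul_rV_lin1 /= /G; congr (rowf (T _)).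
by apply/ffunP=> x; rewrite ffunE mxE enum_rankK.
Qed.

Section SelfAdjoint.
Variables (I : finType) (T : {ffun I -> R} -> {ffun I -> R}).
Hypothesis Tlin : flinear T.
Hypothesis Tsym : forall u v, inner (T u) v = inner u (T v).

Lemma opmx_sym : (opmx T)^T = opmx T.
Proof.
apply/matrixP=> i j; rewrite !mxE -[LHS]inner_delta Tsym innerC.
by rewrite inner_delta.
Qed.

Lemma qform_rowf u : qform (opmx T) (rowf u) = inner (T u) u.
Proof. by rewrite /qform -[opmx T]/(fmx T) rowf_fmx // -/(dot _ _) dot_rowf. Qed.

(** Operator eigenvalues are counted from 1, matrix eigenvalues from 0. *)
Lemma eigvalE k : eigval T k.+1 = (mx_eigenvalues (opmx T))`_k.
Proof. by []. Qed.

Lemma eigval_le i j : (i <= j)%N -> (j <= #|I|)%N -> eigval T i <= eigval T j.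
Proof.
move=> ij jI; have [ssz ssort _] := spectral_theorem opmx_sym.
have [j0|j0] := posnP j; first by move: ij; rewrite j0 leqn0 => /eqP->.
by apply: sorted_nth_le => //; [lia|rewrite [size _]ssz; lia].
Qed.

Lemma eigval_attained k : (0 < k <= #|I|)%N ->
  exists2 v, inner v v = 1 & inner (T v) v = eigval T k.
Proof.
case: k => // k /= kI.
have [v [vv vT]] := eigenvalue_eigenvector (Ordinal kI) opmx_sym.
by exists (frow v); [rewrite -dot_rowf frowK|rewrite -qform_rowf frowK].
Qed.

Lemma second_eigval_ge t : (1 < #|I|)%N ->
  (forall u : {ffun I -> R}, \sum_x u x = 0 -> t * inner u u <= inner (T u) u) ->
  t <= eigval T 2.
Proof.
move=> I1 H; apply: (@second_eigenvalue_ge _ _ _ (rowf [ffun=> 1])) => //.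
  exact: opmx_sym.
move=> v; rewrite -[v]frowK qform_rowf !dot_rowf => v1; apply: H.
by rewrite -[RHS]v1; apply: eq_bigr => x _; rewrite !ffunE mulr1.
Qed.

Hypothesis Tpos : forall u, 0 <= inner (T u) u.
Hypothesis T1 : T [ffun=> 1] = 0.
Hypothesis I0 : (0 < #|I|)%N.

Let one_neq0 : rowf [ffun=> 1 : R] != 0 :> 'rV_#|I|.
Proof.
apply/eqP=> /rowP/(_ (Ordinal I0)); rewrite !mxE ffunE => /eqP.
by rewrite oner_eq0.
Qed.

Let one_ker : rowf [ffun=> 1] *m opmx T = 0.
Proof.
rewrite -[opmx T]/(fmx T) rowf_fmx // T1.
by apply/rowP=> i; rewrite !mxE ffunE.
Qed.

Let qpos v : 0 <= qform (opmx T) v.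
Proof. by rewrite -[v]frowK qform_rowf. Qed.

Lemma first_eigval_eq0 : eigval T 1 = 0.
Proof. exact: (first_eigenvalue_eq0 opmx_sym qpos one_ker one_neq0). Qed.

(** Apply [eigenvalue_gap] to [w], which is [u] minus its mean [c]. The form does not change, since
    [T] is symmetric and kills constants, while the squared norm drops by the squared sum over
    [#|I|]. *)
Lemma second_eigval_gap t (u : {ffun I -> R}) : t <= eigval T 2 ->
  t * (inner u u - (\sum_x u x) ^+ 2 / #|I|%:R) <= inner (T u) u.
Proof.
move=> t2; pose c := (\sum_x u x) / #|I|%:R.
pose w := [ffun x => - c * [ffun=> 1] x + u x].
have cI : c * #|I|%:R = \sum_x u x by rewrite /c divfK // pnatr_eq0 -lt0n.
have w1 : dot (rowf w) (rowf [ffun=> 1]) = 0.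
  rewrite dot_rowf /inner; under eq_bigr do rewrite !ffunE !mulr1.
  by rewrite big_split /= sumr_const -mulr_natr mulNr cI addNr.
have := eigenvalue_gap opmx_sym qpos one_ker one_neq0 t2 w1.
rewrite qform_rowf dot_rowf.
have -> : inner w w = inner u u - (\sum_x u x) ^+ 2 / #|I|%:R.
  have -> : inner w w = inner u u - 2 * c * (\sum_x u x) + c ^+ 2 * #|I|%:R.
    rewrite mulr_natr -sumr_const mulr_sumr -sumrB -big_split /=.
    by apply: eq_bigr => x _; rewrite !ffunE; ring.
  rewrite -cI mulrA; field; by rewrite pnatr_eq0 -lt0n.
have -> : inner (T w) w = inner (T u) u => //.
have Tw : T w = T u.
  by rewrite Tlin T1; apply/ffunP=> x; rewrite !ffunE mulr0 add0r.
rewrite Tw; have : inner (T u) [ffun=> 1] = 0.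
  by rewrite Tsym T1 /inner big1 // => x _; rewrite [X in _ * X]ffunE mulr0.
rewrite /inner => s0; apply/eqP; rewrite -subr_eq0 -sumrB.
under eq_bigr => x _ do rewrite -mulrBr !ffunE mulr1 addrK mulrN.
have : \sum_x T u x * c = 0.
  rewrite -mulr_suml; move: s0; under eq_bigr do rewrite ffunE mulr1.
  by move->; rewrite mul0r.
by rewrite sumrN => ->; rewrite oppr0.
Qed.
End SelfAdjoint.

(** * Comparison of operators related by an extension map *)

Section Extension.
Variables (I J : finType).
Variables (S : {ffun J -> R} -> {ffun J -> R}) (T : {ffun I -> R} -> {ffun I -> R}).
Variables (P K : {ffun J -> R} -> {ffun I -> R}).
Hypotheses (Slin : flinear S) (Tlin : flinear T) (Plin : flinear P) (Klin : flinear K).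
Hypothesis Ssym : forall u v, inner (S u) v = inner u (S v).
Hypothesis Tsym : forall u v, inner (T u) v = inner u (T v).
Hypothesis Spos : forall f, 0 <= inner (S f) f.
Hypothesis formP : forall f, inner (T (P f)) (P f) = inner (S f) f.
Hypothesis normP : forall f, inner (P f) (P f) = inner f f + inner (K f) (K f).
Hypothesis JI : (#|J| <= #|I|)%N.

Let Spos' f : 0 <= qform (opmx S) f.
Proof. by rewrite -[f]frowK qform_rowf. Qed.

Let formP' f : qform (opmx T) (f *m fmx P) = qform (opmx S) f.
Proof. by rewrite -[f]frowK rowf_fmx // !qform_rowf. Qed.

Let normP' f : dot (f *m fmx P) (f *m fmx P) = dot f f + dot (f *m fmx K) (f *m fmx K).
Proof. by rewrite -[f]frowK !rowf_fmx // !dot_rowf. Qed.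

Lemma eigval_extension_le k : (0 < k <= #|J|)%N -> eigval T k <= eigval S k.
Proof.
case: k => // k /= kJ; rewrite !eigvalE.
apply: (eigenvalue_compression_le (opmx_sym Ssym) (opmx_sym Tsym)
  Spos' formP' normP') => //; exact: leq_trans JI.
Qed.

Lemma eigval_extension_eq :
  (forall k, (0 < k <= #|J|)%N -> eigval S k = eigval T k) ->
  (forall f, inner (S f) f = 0 -> exists b, forall x, f x = b) ->
  forall f : {ffun J -> R}, \sum_x f x = 0 -> K f = 0.
Proof.
move=> eigE ker f f0.
have eigE' k : (k < #|J|)%N ->
    (mx_eigenvalues (opmx S))`_k = (mx_eigenvalues (opmx T))`_k.
  by move=> kJ; rewrite -!eigvalE eigE.
have : rowf f *m fmx K = 0.
  apply: (defect0 (opmx_sym Ssym) (opmx_sym Tsym) Spos' formP' normP'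
    JI eigE' (e := rowf [ffun=> 1])).
    move=> v; rewrite -[v]frowK qform_rowf // => /ker[b bE]; exists b.
    by apply/rowP=> i; rewrite !mxE [X in _ * X]ffunE mulr1 bE.
  by rewrite dot_rowf -[RHS]f0; apply: eq_bigr => x _; rewrite ffunE mulr1.
rewrite rowf_fmx // => /rowP Kf; apply/ffunP=> x.
by have := Kf (enum_rank x); rewrite !mxE enum_rankK ffunE.
Qed.
End Extension.
End FunctionRows.

(** * Energy of the graph Laplacian *)

Section Laplacian.
Variables (R : realType) (V : finType) (e : rel V).
Implicit Types u v : {ffun V -> R}.

Lemma neg_laplacianE u x :
  neg_laplacian e u x = \sum_y (u x - u y) * (e x y)%:R.
Proof.
by rewrite /neg_laplacian !ffunE -sumrN; apply: eq_bigr => y _; rewrite -mulNr opprB.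
Qed.

Lemma neg_laplacian_linear : flinear (neg_laplacian (R := R) e).
Proof.
move=> a u v; apply/ffunP=> x; rewrite neg_laplacianE [RHS]ffunE !neg_laplacianE.
rewrite mulr_sumr -big_split; apply: eq_bigr => y _ /=; rewrite !ffunE; ring.
Qed.

Lemma neg_laplacian_one : neg_laplacian e [ffun=> 1 : R] = 0.
Proof.
apply/ffunP=> x; rewrite neg_laplacianE big1 ?ffunE // => y _.
by rewrite !ffunE subrr mul0r.
Qed.

Hypothesis e_sym : symmetric e.

(** Exchanging the two summation variables and adding the result symmetrizes the form; the factor 2
    counts both orientations of each edge. *)
Lemma greens_identity u v : inner (neg_laplacian e u) v *+ 2
  = \sum_x \sum_y (u x - u y) * (v x - v y) * (e x y)%:R.
Proof.
have E : inner (neg_laplacian e u) v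
    = \sum_x \sum_y (u x - u y) * v x * (e x y)%:R.
  apply: eq_bigr => x _; rewrite neg_laplacianE mulr_suml.
  by apply: eq_bigr => y _; ring.
rewrite mulr2n {1}E E [X in X + _]exchange_big -big_split; apply: eq_bigr => x _ /=.
rewrite -big_split; apply: eq_bigr => y _ /=; rewrite [e y x]e_sym; ring.
Qed.

Lemma neg_laplacian_sym u v :
  inner (neg_laplacian e u) v = inner u (neg_laplacian e v).
Proof.
apply/eqP; rewrite -(eqr_pMn2r (isT : (0 < 2)%N)) [in eqbRHS]innerC !greens_identity.
apply/eqP; by apply: eq_bigr => x _; apply: eq_bigr => y _; ring.
Qed.

Lemma neg_laplacian_ge0 u : 0 <= inner (neg_laplacian e u) u.
Proof.
rewrite -(@pmulrn_lge0 _ _ 2) // greens_identity; apply: sumr_ge0 => x _.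
by apply: sumr_ge0 => y _; rewrite mulr_ge0 // -expr2 sqr_ge0.
Qed.

(** A vanishing sum of squares makes [u] constant across each edge, hence along paths. *)
Lemma neg_laplacian_eq0 u : inner (neg_laplacian e u) u = 0 ->
  forall x y, connect e x y -> u x = u y.
Proof.
move=> E0.
have step x y : e x y -> u x = u y.
  move=> exy; apply/eqP; rewrite -subr_eq0 -sqrf_eq0.
  have pos (a b : V) : 0 <= (u a - u b) * (u a - u b) * (e a b)%:R.
    by rewrite mulr_ge0 // -expr2 sqr_ge0.
  have := greens_identity u u; rewrite E0 mul0rn => /esym/eqP.
  rewrite psumr_eq0 => [/allP/(_ x)|? _]; last exact: sumr_ge0.
  rewrite mem_index_enum psumr_eq0 //= => /(_ isT)/allP/(_ y).
  by rewrite mem_index_enum exy mulr1 => /(_ isT).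
move=> x y /connectP[p]; elim: p x => [|z p IH] x /=; first by move=> _ ->.
by move=> /andP[exz pz] yl; rewrite (step _ _ exz) (IH z).
Qed.

End Laplacian.

(** * Induced subgraphs and the energy of a join *)

Section Induced.
Variables (R : realType) (V : finType) (e : rel V).
Hypothesis e_sym : symmetric e.
Implicit Types u v : {ffun V -> R}.

Definition restrictf (C : {set V}) u : {ffun {x : V | x \in C} -> R} :=
  [ffun z => u (val z)].

Lemma sum_restrict (C : {set V}) (F : V -> R) :
  \sum_(x in C) F x = \sum_(z : {x : V | x \in C}) F (val z).
Proof. exact: big_sub. Qed.

Lemma card_restrict (C : {set V}) : #|{: {x : V | x \in C}}| = #|C|.
Proof. by rewrite card_sig; apply: eq_card => x; rewrite inE. Qed.

Lemma inner_restrict (C : {set V}) u v :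
  inner (restrictf C u) (restrictf C v) = \sum_(x in C) u x * v x.
Proof. by rewrite sum_restrict; apply: eq_bigr => z _; rewrite !ffunE. Qed.

Lemma inner_induced (C : {set V}) u :
  inner (neg_laplacian (induced e (S := C)) (restrictf C u)) (restrictf C u)
    = \sum_(x in C) \sum_(y in C) u x * (u x - u y) * (e x y)%:R.
Proof.
rewrite sum_restrict; apply: eq_bigr => z _.
rewrite neg_laplacianE mulr_suml sum_restrict; apply: eq_bigr => t _.
by rewrite !ffunE; ring.
Qed.

Lemma sum_setC (C : {set V}) (F : V -> R) :
  \sum_x F x = \sum_(x in C) F x + \sum_(x in ~: C) F x.
Proof.
rewrite (bigID (mem C)) /=; congr (_ + _).
by apply: eq_bigl => x; rewrite inE.
Qed.

(** Split the ordered pairs according to the side of each endpoint. Pairs on the same side give the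
    induced forms; on mixed pairs every weight is 1, so the double sum expands into sums of squares
    and a product of sums, once per orientation. *)
Lemma join_form (C : {set V}) u : {in C & ~: C, forall x y, e x y} ->
  inner (neg_laplacian e u) u
    = inner (neg_laplacian (induced e (S := C)) (restrictf C u)) (restrictf C u)
    + inner (neg_laplacian (induced e (S := ~: C)) (restrictf (~: C) u))
        (restrictf (~: C) u)
    + #|~: C|%:R * (\sum_(x in C) u x ^+ 2) + #|C|%:R * (\sum_(x in ~: C) u x ^+ 2)
    - 2 * (\sum_(x in C) u x) * (\sum_(x in ~: C) u x).
Proof.
move=> join; rewrite !inner_induced.
have -> : inner (neg_laplacian e u) u = \sum_x \sum_y u x * (u x - u y) * (e x y)%:R.
  apply: eq_bigr => x _; rewrite neg_laplacianE mulr_suml.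
  by apply: eq_bigr => y _; ring.
have cross (A B : {set V}) : {in A & B, forall x y, e x y} ->
    \sum_(x in A) \sum_(y in B) u x * (u x - u y) * (e x y)%:R
    = #|B|%:R * (\sum_(x in A) u x ^+ 2) - (\sum_(x in A) u x) * (\sum_(x in B) u x).
  move=> AB; rewrite mulr_suml mulr_sumr -sumrB; apply: eq_bigr => x xA.
  under eq_bigr => y yB do rewrite AB // mulr1 mulrBr.
  by rewrite sumrB sumr_const -mulr_sumr -expr2 -[_ *+ _]mulr_natl.
rewrite [LHS](sum_setC C).
under eq_bigr => x _ do rewrite (sum_setC C).
under [X in _ + X]eq_bigr => x _ do rewrite (sum_setC C).
rewrite !big_split /= (cross C (~: C)) // (cross (~: C) C) => [|x y xC yC]; last first.
  by rewrite e_sym join.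
ring.
Qed.
End Induced.

(** * The Dirichlet-to-Neumann map *)

Section Steklov.
Variables (R : realType) (V : finType) (e : rel V) (B : {set V}).
Hypotheses (Ge : connected_graph e) (GB : boundary e B).
Local Notation J := {x : V | x \in B}.
Implicit Types f g : {ffun J -> R}.

Let neg_laplacian_opp (u : {ffun V -> R}) x : neg_laplacian e u x = - laplacian e u x.
Proof. by rewrite [LHS]ffunE. Qed.

Let e_sym : symmetric e. Proof. by case: Ge. Qed.

Lemma harm_ext_boundary f b : harm_ext e f (val b) = f b.
Proof. by have [] := harm_extP Ge GB f. Qed.

Lemma neg_laplacian_harm_ext f x : x \in ~: B -> neg_laplacian e (harm_ext e f) x = 0.
Proof.
move=> xB; have [_ /(_ x xB) Lx] := harm_extP Ge GB f.
by rewrite neg_laplacian_opp Lx oppr0.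
Qed.

Lemma harm_ext_eq f (u : {ffun V -> R}) : (forall b, u (val b) = f b) ->
  {in ~: B, forall x, neg_laplacian e u x = 0} -> harm_ext e f = u.
Proof.
move=> uf u0; apply: (harmonic_extension_unique Ge GB (harm_extP Ge GB f)).
split=> // x /u0 /eqP; rewrite neg_laplacian_opp oppr_eq0.
by move/eqP.
Qed.

Lemma harm_ext_linear : flinear (harm_ext (R := R) e (B := B)).
Proof.
move=> a f g; apply: harm_ext_eq => [b|x xB].
  by rewrite !ffunE !harm_ext_boundary.
by rewrite neg_laplacian_linear ffunE !neg_laplacian_harm_ext // mulr0 addr0.
Qed.

Lemma harm_ext_one : harm_ext e ([ffun=> 1] : {ffun J -> R}) = [ffun=> 1].
Proof. by apply: harm_ext_eq => [b|x xB]; rewrite ?neg_laplacian_one !ffunE. Qed.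

Lemma DtNE f b : DtN e f b = neg_laplacian e (harm_ext e f) (val b).
Proof. by rewrite neg_laplacianE ffunE. Qed.

(** Summing over all of [V] adds nothing to the boundary sum, as the Laplacian of a harmonic
    extension vanishes in the interior. So the Steklov form is the energy of the extension. *)
Lemma DtN_form f g :
  inner (DtN e f) g = inner (neg_laplacian e (harm_ext e f)) (harm_ext e g).
Proof.
rewrite [RHS](sum_setC B) [X in _ + X]big1 ?addr0 => [|x xB]; last first.
  by rewrite neg_laplacian_harm_ext // mul0r.
by rewrite sum_restrict; apply: eq_bigr => b _; rewrite DtNE harm_ext_boundary.
Qed.

Lemma DtN_linear : flinear (DtN (R := R) e (B := B)).
Proof.
move=> a f g; apply/ffunP=> b.
by rewrite [RHS]ffunE !DtNE harm_ext_linear neg_laplacian_linear ffunE.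
Qed.

Lemma DtN_sym f g : inner (DtN e f) g = inner f (DtN e g).
Proof. by rewrite [RHS]innerC !DtN_form neg_laplacian_sym // innerC. Qed.

Lemma DtN_ge0 f : 0 <= inner (DtN e f) f.
Proof. by rewrite DtN_form neg_laplacian_ge0. Qed.

Lemma DtN_one : DtN e ([ffun=> 1] : {ffun J -> R}) = 0.
Proof.
by apply/ffunP=> b; rewrite DtNE harm_ext_one neg_laplacian_one !ffunE.
Qed.

Lemma DtN_eq0 f : inner (DtN e f) f = 0 -> exists c, forall b, f b = c.
Proof.
have [/set0Pn[b0 b0B] _ _] := GB; have [_ _ con] := Ge.
rewrite DtN_form => /(neg_laplacian_eq0 e_sym) const.
exists (harm_ext e f b0) => b; rewrite -harm_ext_boundary; exact/const/con.
Qed.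

(** Plays the role of [K] in the comparison: its squared norm is what [harm_ext] adds to that of
    [f]. *)
Definition interior_part f : {ffun V -> R} :=
  [ffun x => (x \notin B)%:R * harm_ext e f x].

Lemma interior_part_linear : flinear interior_part.
Proof.
by move=> a f g; apply/ffunP=> x; rewrite !ffunE harm_ext_linear ffunE; ring.
Qed.

Lemma harm_ext_norm f : inner (harm_ext e f) (harm_ext e f)
  = inner f f + inner (interior_part f) (interior_part f).
Proof.
rewrite {1}/inner (sum_setC B); congr (_ + _).
  by rewrite sum_restrict; apply: eq_bigr => b _; rewrite harm_ext_boundary.
rewrite [RHS](sum_setC B) [X in _ = X + _]big1 ?add0r => [|x xB].
  by apply: eq_bigr => x; rewrite inE !ffunE => ->; rewrite !mul1r.
by rewrite !ffunE xB !mul0r.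
Qed.

Lemma card_boundary_le : (#|{: J}| <= #|V|)%N.
Proof. by rewrite card_restrict max_card. Qed.

Lemma laplace_le_steklov i : (0 < i <= #|B|)%N ->
  laplace_eigval R e i <= steklov_eigval R e B i.
Proof.
rewrite -card_restrict.
apply: (eigval_extension_le DtN_linear (@neg_laplacian_linear _ _ _)
  harm_ext_linear interior_part_linear DtN_sym (neg_laplacian_sym e_sym) DtN_ge0
  _ harm_ext_norm card_boundary_le) => f.
by rewrite DtN_form.
Qed.

Lemma steklov_eq_harm_ext :
  (forall i, (0 < i <= #|B|)%N -> steklov_eigval R e B i = laplace_eigval R e i) ->
  forall f, \sum_b f b = 0 -> {in ~: B, forall x, harm_ext e f x = 0}.
Proof.
rewrite -card_restrict => eigE f f0 x; rewrite inE => xB.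
have /ffunP/(_ x) : interior_part f = 0.
  apply: (eigval_extension_eq DtN_linear (@neg_laplacian_linear _ _ _)
    harm_ext_linear interior_part_linear DtN_sym (neg_laplacian_sym e_sym) DtN_ge0
    _ harm_ext_norm card_boundary_le eigE DtN_eq0) => // g.
  by rewrite DtN_form.
by rewrite !ffunE xB mul1r.
Qed.

(** Condition (1) of the theorem. *)
Definition boundary_uniform : Prop := forall x, x \in Omega B ->
  (forall y, y \in B -> e x y) \/ (forall y, y \in B -> ~~ e x y).

Lemma harm_ext_vanish_uniform :
  (forall f, \sum_b f b = 0 -> {in ~: B, forall x, harm_ext e f x = 0}) ->
  boundary_uniform.
Proof.
move=> vanish x xO.
have same b c : b \in B -> c \in B -> e x b = e x c.
  move=> bB cB; pose b' : J := exist _ b bB; pose c' : J := exist _ c cB.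
  (* The extension of this mean-zero function vanishes in the interior, so harmonicity at [x]
     involves only [b] and [c] and says that their weights to [x] are equal. *)
  pose f : {ffun J -> R} := [ffun z => (z == b')%:R - (z == c')%:R].
  have sumd (F : J -> R) (z : J) : \sum_t (t == z)%:R * F t = F z.
    rewrite (bigD1 z) //= eqxx mul1r big1 ?addr0 // => t /negbTE->.
    by rewrite mul0r.
  have f0 : \sum_z f z = 0.
    under eq_bigr => z _ do rewrite ffunE -[(z == b')%:R]mulr1 -[(z == c')%:R]mulr1.
    by rewrite sumrB !(sumd (fun=> 1)) subrr.
  have := neg_laplacian_harm_ext f xO; rewrite neg_laplacianE (sum_setC B).
  rewrite (vanish f f0 x xO) [X in _ + X]big1 ?addr0 => [|y yO]; last first.
    by rewrite vanish // subrr mul0r.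
  rewrite sum_restrict.
  under eq_bigr => z _ do rewrite harm_ext_boundary sub0r mulNr ffunE mulrBl.
  rewrite sumrN sumrB !(sumd (fun z => (e x (val z))%:R)) /= => /eqP.
  rewrite oppr_eq0 subr_eq0 eqr_nat; by case: (e x b) (e x c) => [] [].
have [/set0Pn[b bB] _ _] := GB.
case exb : (e x b); [left|right] => y yB; first by rewrite (same y b).
by rewrite (same y b) // exb.
Qed.

Lemma Omega01C : ~: Omega1 e B = B :|: Omega0 e B.
Proof.
apply/setP=> x; rewrite !inE; case: (x \in B);
  by rewrite ?andbT ?negbK ?andbF.
Qed.

Lemma boundary_Omega0_disjoint : [disjoint B & Omega0 e B].
Proof. by apply/pred0P=> x /=; rewrite !inE; case: (x \in B). Qed.

Lemma card_Omega1C : #|~: Omega1 e B| = (#|B| + #|Omega0 e B|)%N.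
Proof.
rewrite Omega01C cardsU disjoint_setI0 ?cards0 ?subn0 //.
exact: boundary_Omega0_disjoint.
Qed.

Lemma Omega0_boundary x b : x \in Omega0 e B -> b \in B -> e x b = false.
Proof. by rewrite inE => /andP[_ /forall_inP H] /H/negbTE. Qed.

(** Boundary vertices are pairwise nonadjacent, and a vertex outside [B] and [Omega0] has some
    boundary neighbour, hence by uniformity all of them. *)
Lemma uniform_boundary_edge b y : boundary_uniform -> b \in B ->
  e b y = (y \in Omega1 e B).
Proof.
move=> unif bB; have [_ BB _] := GB.
have [yB|yB] := boolP (y \in B).
  by rewrite (negbTE (BB _ _ bB yB)) !inE yB /= ?andbF.
have [y0|y0] := boolP (y \in Omega0 e B).
  by rewrite e_sym (Omega0_boundary y0 bB) inE y0.
rewrite inE y0 inE yB /= e_sym; have yO : y \in Omega B by rewrite inE.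
case: (unif y yO) => [->//|none]; case/negP: y0.
by rewrite inE yO; apply/forall_inP.
Qed.

Lemma Omega1_neq0 : boundary_uniform -> (0 < #|Omega1 e B|)%N.
Proof.
move=> unif; have [/set0Pn[b bB] _ adj] := GB; have [y _ eby] := adj b bB.
by apply/card_gt0P; exists y; rewrite -(uniform_boundary_edge _ unif bB).
Qed.

(** The harmonic extension is the mean [k] of [f] on the whole interior: a vertex of [Omega1] sees
    every boundary value once, and their deviations from [k] cancel; a vertex of [Omega0] sees only
    the value [k]. Each boundary vertex then has exactly [Omega1] as neighbours. *)
Lemma uniform_DtN f b : boundary_uniform ->
  DtN e f b = #|Omega1 e B|%:R * (f b - (\sum_c f c) / #|B|%:R).
Proof.
move=> unif; set k := _ / _.
have B0 : #|B|%:R != 0 :> R by have [? _ _] := GB; rewrite pnatr_eq0 cards_eq0.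
pose u : {ffun V -> R} := [ffun x => oapp f k (insub x)].
have uB c : u (val c) = f c by rewrite ffunE valK.
have uO x : x \notin B -> u x = k by move=> xB; rewrite ffunE insubF //; exact/negbTE.
have -> : DtN e f b = neg_laplacian e u (val b).
  rewrite DtNE (harm_ext_eq uB) // => x; rewrite inE => xB.
  rewrite neg_laplacianE (sum_setC B) [X in _ + X]big1 ?addr0 => [|y]; last first.
    by rewrite inE => yB; rewrite !uO // subrr mul0r.
  rewrite uO // sum_restrict.
  under eq_bigr => c _ do rewrite uB.
  have xO : x \in Omega B by rewrite inE.
  have [all|none] := unif x xO.
    under eq_bigr => c _ do rewrite all ?(valP c) // mulr1.
    by rewrite sumrB sumr_const card_restrict -mulr_natr /k divfK // subrr.
  by rewrite big1 // => c _; rewrite (negbTE (none _ (valP c))) mulr0.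
rewrite neg_laplacianE uB.
under eq_bigr => y _ do rewrite (uniform_boundary_edge _ unif (valP b)).
rewrite (sum_setC (Omega1 e B)) [X in _ + X]big1 ?addr0 => [|y]; last first.
  by rewrite inE => /negbTE->; rewrite mulr0.
rewrite mulr_natl -sumr_const; apply: eq_bigr => y yO; rewrite yO mulr1 uO //.
by move: yO; rewrite !inE => /andP[].
Qed.

Lemma uniform_DtN_form f : boundary_uniform ->
  inner (DtN e f) f
    = #|Omega1 e B|%:R * (inner f f - (\sum_c f c) ^+ 2 / #|B|%:R).
Proof.
move=> unif; rewrite {1}/inner; under eq_bigr => b _ do rewrite uniform_DtN //.
have -> : (\sum_c f c) ^+ 2 / #|B|%:R = \sum_b (\sum_c f c) / #|B|%:R * f b.
  by rewrite -mulr_sumr; ring.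
by rewrite -sumrB mulr_sumr; apply: eq_bigr => b _; ring.
Qed.
End Steklov.

(** * Counting edges between disjoint sets *)

Lemma card_edges_between (V : finType) (e : rel V) (S T : {set V}) :
  [disjoint S & T] ->
  #|edges_between e S T| = #|[set p : V * V | [&& p.1 \in S, p.2 \in T & e p.1 p.2]]|.
Proof.
move=> ST; pose h (p : V * V) : {set V} := [set p.1; p.2].
have STF x : x \in S -> x \in T -> False.
  by move=> xS xT; have /pred0P/(_ x) := ST; rewrite /= xS xT.
set D := [set p | _].
have -> : edges_between e S T = h @: D.
  apply/setP=> A; apply/imset2P/imsetP => [[x y xS yT ->]|[[x y] xy ->]].
    by exists (x, y) => //; rewrite inE /=; move: yT; rewrite inE xS => /andP[-> ->].
  move: xy; rewrite inE /= => /and3P[xS yT exy].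
  by exists x y => //; rewrite inE yT.
(* Disjointness tells the endpoints apart, so an unordered edge determines its ordered pair. *)
rewrite card_in_imset // => -[x y] [x' y']; rewrite !inE /=.
move=> /and3P[xS yT _] /and3P[xS' yT' _] /setP E.
have := E x; rewrite !inE eqxx /= => /esym/orP[/eqP xx|/eqP xy]; last first.
  by case: (STF x) => //; rewrite xy.
have := E y; rewrite !inE eqxx orbT => /esym/orP[/eqP yx|/eqP yy]; last first.
  by rewrite xx yy.
by case: (STF y) => //; rewrite yx.
Qed.

Lemma edges_between_full (V : finType) (e : rel V) (S T : {set V}) :
  [disjoint S & T] ->
  #|edges_between e S T| = (#|S| * #|T|)%N <-> {in S & T, forall x y, e x y}.
Proof.
move=> ST; rewrite card_edges_between // -cardsX.
set D := [set p | _].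
have DS : D \subset finset.setX S T.
  by apply/subsetP=> -[x y]; rewrite !inE /= => /and3P[-> ->].
split=> [DE x y xS yT|all].
  have /setP/(_ (x, y)) : D = finset.setX S T by apply/eqP; rewrite eqEcard DS DE leqnn.
  by rewrite !inE /= xS yT.
apply: eq_card => -[x y]; rewrite !inE /=.
by case: (boolP (x \in S)) => //= xS; case: (boolP (y \in T)) => //= yT; rewrite all.
Qed.

(** * The spectral gap and the join structure *)

Section SpectralGap.
Variables (R : realType) (V : finType) (e : rel V) (B : {set V}).
Hypotheses (Ge : connected_graph e) (GB : boundary e B).
Hypothesis unif : boundary_uniform e B.
Local Notation O0 := (Omega0 e B).
Local Notation O1 := (Omega1 e B).

Let e_sym : symmetric e. Proof. by case: Ge. Qed.

(** The inequality [mu_2 >= |Omega1|] in variational form. *)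
Definition Omega1_gap : Prop := forall u : {ffun V -> R}, \sum_x u x = 0 ->
  #|O1|%:R * inner u u <= inner (neg_laplacian e u) u.

Lemma sum_vertices (F : V -> R) :
  \sum_x F x = \sum_(x in O1) F x + \sum_(x in B) F x + \sum_(x in O0) F x.
Proof.
rewrite (sum_setC O1) Omega01C -addrA; congr (_ + _).
rewrite -bigU ?boundary_Omega0_disjoint //.
by apply: eq_bigl => x; rewrite !inE.
Qed.

(* Tested against the mean-zero function equal to [|Omega0|] on [B], [- |B|] on
   [Omega0] and [0] on [Omega1], the gap bounds the number of edges below. *)
Lemma gap_complete : Omega1_gap -> {in O0 & O1, forall x y, e x y}.
Proof.
move=> gap; have [a aE] : exists a : R, a = #|O0|%:R by eexists.
have [b bE] : exists b : R, b = - #|B|%:R by eexists.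
pose u : {ffun V -> R} := [ffun x => if x \in B then a else if x \in O0 then b else 0].
have uB x : x \in B -> u x = a by rewrite ffunE => ->.
have nB x : x \in O0 -> x \notin B by rewrite !inE => /andP[].
have u0 x : x \in O0 -> u x = b by move=> x0; rewrite ffunE (negbTE (nB x x0)) x0.
have u1 x : x \in O1 -> u x = 0.
  by rewrite ffunE inE => /andP[/negbTE-> +]; rewrite inE => /negbTE->.
have sum0 : \sum_x u x = 0.
  rewrite sum_vertices big1 // add0r (eq_bigr _ uB) (eq_bigr _ u0) !sumr_const.
  by rewrite -(mulr_natr a) -(mulr_natr b) -aE -[#|B|%:R]opprK -bE mulrN mulrC addNr.
have LB x : x \in B -> neg_laplacian e u x * u x = #|O1|%:R * a ^+ 2.
  move=> xB; rewrite neg_laplacianE uB //.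
  under eq_bigr => y _ do rewrite (uniform_boundary_edge Ge GB _ unif xB).
  rewrite (sum_setC O1) [X in _ + X]big1 ?addr0 => [|y]; last first.
    by rewrite inE => /negbTE->; rewrite mulr0.
  rewrite (eq_bigr (fun=> a)) => [|y yO]; last by rewrite yO u1 // subr0 mulr1.
  by rewrite sumr_const -(mulr_natr a) mulrAC -expr2 mulrC.
have L0 x : x \in O0 ->
    neg_laplacian e u x * u x = b ^+ 2 * \sum_(y in O1) (e x y)%:R.
  move=> x0; rewrite neg_laplacianE u0 // sum_vertices [X in _ + X]big1 ?addr0; last first.
    by move=> y y0; rewrite u0 // subrr mul0r.
  rewrite [X in _ + X]big1 ?addr0 => [|y yB]; last first.
    by rewrite (Omega0_boundary x0 yB) mulr0.
  rewrite mulr_suml mulr_sumr; apply: eq_bigr => y y1; rewrite u1 //; ring.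
have normE : inner u u = #|B|%:R * a ^+ 2 + #|O0|%:R * b ^+ 2.
  rewrite /inner sum_vertices big1 => [|x x1]; last by rewrite u1 // mulr0.
  rewrite add0r (eq_bigr (fun=> a ^+ 2)) => [|x xB]; last by rewrite uB.
  rewrite [X in _ + X](eq_bigr (fun=> b ^+ 2)) => [|x x0]; last by rewrite u0.
  by rewrite !sumr_const -(mulr_natl (a ^+ 2)) -(mulr_natl (b ^+ 2)).
have formE : inner (neg_laplacian e u) u = #|B|%:R * (#|O1|%:R * a ^+ 2)
    + b ^+ 2 * \sum_(x in O0) \sum_(y in O1) (e x y)%:R.
  rewrite /inner sum_vertices big1 => [|x x1]; last by rewrite u1 // mulr0.
  rewrite add0r (eq_bigr _ LB) (eq_bigr _ L0) sumr_const -[X in _ + X = _]mulr_sumr.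
  by rewrite -(mulr_natl (_ * a ^+ 2)).
have b2 : 0 < b ^+ 2.
  have [? _ _] := GB.
  by rewrite exprn_even_gt0 //= bE oppr_eq0 pnatr_eq0 cards_eq0.
(* The boundary contributions to the two sides cancel, and dividing by [b ^+ 2] leaves
   [|Omega0| |Omega1|] at most the number of edges between the two sets. *)
have := gap u sum0; rewrite normE formE mulrDr mulrCA lerD2l.
rewrite mulrA mulrC ler_pM2l // => le.
have le1 x y : 0 <= 1 - (e x y)%:R :> R by case: (e x y); rewrite ?subr0 ?subrr.
(* This sum counts the missing edges. *)
have : \sum_(x in O0) \sum_(y in O1) (1 - (e x y)%:R : R) == 0.
  rewrite eq_le; apply/andP; split; last first.
    by apply: sumr_ge0 => x _; apply: sumr_ge0.
  under eq_bigr => x _ do rewrite sumrB sumr_const.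
  by rewrite sumrB sumr_const -mulr_natr subr_le0.
rewrite psumr_eq0 => [/allP H x y x0 y1|x _]; last exact: sumr_ge0.
have := H x; rewrite mem_index_enum x0 psumr_eq0 // => /(_ isT)/allP/(_ y).
by rewrite mem_index_enum y1 => /(_ isT); case: (e x y); rewrite //= subr0 oner_eq0.
Qed.

Hypothesis complete : {in O0 & O1, forall x y, e x y}.

Lemma Omega1_join : {in O1 & ~: O1, forall x y, e x y}.
Proof.
move=> x y x1; rewrite Omega01C e_sym inE => /orP[yB|y0]; last exact: complete.
by rewrite (uniform_boundary_edge Ge GB _ unif yB).
Qed.

(** For [g] of mean zero on [Omega1], extended by 0, the join formula leaves the induced form plus
    [(|B| + |Omega0|) |g|^2]; the gap therefore bounds the induced form below by the stated
    constant. *)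
Lemma gap_induced : Omega1_gap -> (1 < #|O1|)%N ->
  #|O1|%:R - #|O0|%:R - #|B|%:R <= laplace_eigval R (induced e (S := O1)) 2.
Proof.
move=> gap O12; apply: second_eigval_ge.
- by apply: neg_laplacian_linear.
- by apply: neg_laplacian_sym => x y; exact: e_sym.
- by rewrite card_restrict.
move=> g g0; pose u : {ffun V -> R} := [ffun x => oapp g 0 (insub x)].
have gE : restrictf O1 u = g by apply/ffunP=> z; rewrite !ffunE valK.
have u0 x : x \in ~: O1 -> u x = 0.
  by rewrite inE => x1; rewrite ffunE insubF //; exact/negbTE.
have sum0 : \sum_x u x = 0.
  rewrite (sum_setC O1) [X in _ + X]big1 // addr0 sum_restrict -[RHS]g0.
  by apply: eq_bigr => z _; rewrite -gE [RHS]ffunE.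
have normE : inner u u = inner g g.
  rewrite -gE inner_restrict [LHS](sum_setC O1) [X in _ + X]big1 ?addr0 // => x x1.
  by rewrite u0 // mulr0.
have sqE : \sum_(x in O1) u x ^+ 2 = inner g g.
  by rewrite -gE inner_restrict; apply: eq_bigr.
have rest0 : restrictf (~: O1) u = 0.
  by apply/ffunP=> z; rewrite [LHS]ffunE u0 ?(valP z) // ffunE.
have := gap u sum0; rewrite normE (join_form e_sym _ Omega1_join) gE rest0 sqE.
rewrite [inner _ 0]big1 => [|z _]; last by rewrite [X in _ * X]ffunE mulr0.
rewrite [\sum_(x in ~: _) _ ^+ 2]big1 => [|x x1]; last by rewrite u0 // expr0n.
rewrite [\sum_(x in ~: _) _]big1 => [|x x1]; last by rewrite u0.
rewrite card_Omega1C natrD !mulr0 subr0 !addr0.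
by rewrite !mulrBl mulrDl; lra.
Qed.

(** Let [s] be the sum of [u] over [Omega1]; the sum over the complement is [- s], so the cross term
    of the join formula becomes [+ 2 s^2]. The bound on [mu_2(Omega1)] controls the induced form [X]
    only up to the mean of [u] on [Omega1], at a cost of at most [s^2], which the cross term
    covers. *)
Lemma induced_gap : ((1 < #|O1|)%N ->
    #|O1|%:R - #|O0|%:R - #|B|%:R <= laplace_eigval R (induced e (S := O1)) 2) ->
  Omega1_gap.
Proof.
move=> mu2 u sum0; rewrite (join_form e_sym _ Omega1_join).
have O10 := Omega1_neq0 Ge GB unif.
have ind_sym (C : {set V}) : symmetric (@induced V e C) by move=> x y; exact: e_sym.
set X := inner _ (restrictf O1 u); set Y := inner _ (restrictf (~: O1) u).
have Y0 : 0 <= Y by exact: (neg_laplacian_ge0 (ind_sym _)).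
have [k kE] : exists k : R, k = #|O1|%:R by eexists.
have [a aE] : exists a : R, a = #|~: O1|%:R by eexists.
have k0 : 0 < k by rewrite kE ltr0n.
have a0 : 0 <= a by rewrite aE.
have sA : \sum_(x in ~: O1) u x = - \sum_(x in O1) u x.
  by apply/eqP; rewrite -addr_eq0 addrC -sum_setC sum0.
have normE : inner u u = \sum_(x in O1) u x ^+ 2 + \sum_(x in ~: O1) u x ^+ 2.
  by rewrite -sum_setC.
rewrite sA normE -kE -aE.
have : (k - a) * (\sum_(x in O1) u x ^+ 2 - (\sum_(x in O1) u x) ^+ 2 / k) <= X.
  have sqE : \sum_(x in O1) u x ^+ 2 = inner (restrictf O1 u) (restrictf O1 u).
    by rewrite inner_restrict; apply: eq_bigr.
  have sE : \sum_(x in O1) u x = \sum_z restrictf O1 u z.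
    by rewrite sum_restrict; apply: eq_bigr => z _; rewrite ffunE.
  have [O12|O11] := ltnP 1 #|O1|.
    rewrite sqE sE kE -(card_restrict O1).
    apply: second_eigval_gap.
    - exact: neg_laplacian_linear.
    - exact: (neg_laplacian_sym (ind_sym _)).
    - exact: (neg_laplacian_ge0 (ind_sym _)).
    - exact: neg_laplacian_one.
    - by rewrite card_restrict.
    by rewrite card_restrict aE card_Omega1C natrD opprD addrCA addrA [- _ + _]addrC
      addrAC mu2.
  (* On a single vertex the variance is 0, so the bound holds without any condition on [mu_2]. *)
  have /eqP/cards1P[x O1E] : #|O1| = 1%N by apply/eqP; rewrite eqn_leq O11.
  rewrite kE O1E cards1 !big_set1 divr1 subrr mulr0.
  exact: (neg_laplacian_ge0 (ind_sym _)).
move: (\sum_(x in O1) u x) (\sum_(x in O1) u x ^+ 2) (\sum_(x in ~: O1) u x ^+ 2).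
move=> s q q' Xle.
have sk : 0 <= a * s ^+ 2 / k := divr_ge0 (mulr_ge0 a0 (sqr_ge0 s)) (ltW k0).
have E : (k - a) * (q - s ^+ 2 / k) = k * q - a * q - s ^+ 2 + a * s ^+ 2 / k.
  by field; rewrite gt_eqF.
have s2 : 0 <= s ^+ 2 := sqr_ge0 s.
have -> : 2 * s * - s = - (2 * s ^+ 2) by ring.
rewrite E in Xle; move: Xle sk s2.
by move: (a * s ^+ 2 / k) (s ^+ 2) => r t; nra.
Qed.
End SpectralGap.

(** * Equality of the Laplacian and Steklov spectra *)

Unset Implicit Arguments.

Theorem corollary1p3 (R : realType) (V : finType) (e : rel V) (B : {set V})
    (Ge : connected_graph e) (GB : boundary e B) (B2 : (2 <= #|B|)%N) :
  (forall i : nat, (1 <= i <= #|B|)%N ->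
     steklov_eigval R e B i = laplace_eigval R e i)
  <->
  [/\ forall x : V, x \in Omega B ->
        (forall y : V, y \in B -> e x y) \/ (forall y : V, y \in B -> ~~ e x y),
      #|edges_between e (Omega0 e B) (Omega1 e B)|
        = (#|Omega0 e B| * #|Omega1 e B|)%N
    & (1 < #|Omega1 e B|)%N ->
        #|Omega1 e B|%:R - #|Omega0 e B|%:R - #|B|%:R
          <= laplace_eigval R (@induced V e (Omega1 e B)) 2].
Proof.
have e_sym : symmetric e by case: Ge.
have V0 : (0 < #|V|)%N by apply: leq_trans (max_card (mem B)); exact: ltnW.
have J0 : (0 < #|{: {x : V | x \in B}}|)%N by rewrite card_restrict ltnW.
have disj : [disjoint Omega0 e B & Omega1 e B].
  by apply/pred0P=> x /=; rewrite [X in _ && X]inE; case: (x \in Omega0 e B).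
have Llin := @neg_laplacian_linear R V e; have Lsym := @neg_laplacian_sym R V e e_sym.
have Lpos := @neg_laplacian_ge0 R V e e_sym; have L1 := @neg_laplacian_one R V e.
have Slin := @DtN_linear R V e B Ge GB; have Ssym := @DtN_sym R V e B Ge GB.
split=> [eigE|[unif /(edges_between_full _ disj) complete mu2] i iB].
  have unif : boundary_uniform e B.
    exact/(harm_ext_vanish_uniform Ge GB)/(steklov_eq_harm_ext Ge GB eigE).
  have gap : Omega1_gap R e B.
    move=> u u0; have := @second_eigval_gap _ _ _ Llin Lsym Lpos L1 V0 #|Omega1 e B|%:R u.
    rewrite u0 expr0n mul0r subr0; apply.
    (* Index 2 is admissible because [2 <= #|B|]; on mean-zero functions the Steklov form is exactly
       [|Omega1| |f|^2], so [sigma_2 >= |Omega1|]. *)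
    rewrite -[eigval _ 2]/(laplace_eigval R e 2) -eigE //.
    apply: (second_eigval_ge Slin Ssym); first by rewrite card_restrict.
    move=> f f0; rewrite (uniform_DtN_form Ge GB _ unif) f0 expr0n mul0r subr0 //.
  have complete := gap_complete Ge GB unif gap.
  split=> //; first exact/edges_between_full.
  exact: (gap_induced Ge GB unif complete gap).
have gap := induced_gap Ge GB unif complete mu2.
have [i1|i1] := leqP i 1.
  have -> : i = 1%N by lia.
  rewrite /steklov_eigval /laplace_eigval (first_eigval_eq0 Llin Lsym) //.
  rewrite (first_eigval_eq0 Slin Ssym) //; [exact: DtN_ge0|exact: DtN_one].
(* For [i >= 2] it remains to chain [sigma_i <= |Omega1| <= mu_2 <= mu_i]. *)
apply/eqP; rewrite eq_le (laplace_le_steklov R Ge GB iB) andbT.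
apply: (@le_trans _ _ #|Omega1 e B|%:R).
  rewrite -(card_restrict B) in iB; rewrite /steklov_eigval.
  (* At a unit vector attaining [sigma_i], the Steklov form is [|Omega1|] times 1 minus a
     nonnegative term. *)
  have [f ff <-] := eigval_attained Slin Ssym iB.
  rewrite (uniform_DtN_form Ge GB _ unif) -[leRHS]mulr1 ler_wpM2l // ff.
  by rewrite gerBl divr_ge0 ?sqr_ge0.
have BV : (#|B| <= #|V|)%N by exact: max_card.
apply: (@le_trans _ _ (laplace_eigval R e 2)); last by apply: eigval_le => //; lia.
apply: second_eigval_ge => //; by lia.
Qed.
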